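(* In order that $(D;G_1)\overline{\int}_E g(I)$ and $(D;G_1)\underline{\int}_E g(I)$ should be finite and equal for every (Lebesgue measurable) set $E$ in $W$ it is necessary and sufficient that the norm-limit of $g(I)$ should exist and be absolutely continuous; that is, that $N(I)=(N;G_1)\int_I g$ exists for every interval $I$ in $W$ and $N$ is an absolutely continuous interval function in $W$.
   Context: $W=[A,B]$ with $A<B$ is a fixed closed interval. An interval is any of $(a,b),[a,b),(a,b],[a,b]$ with $A\le a<b\le B$; $mI=b-a$, and $m$ also denotes Lebesgue measure. Two intervals overlap if they have a non-degenerate interval in common. $g$ is a real-valued function of all the intervals in $W$. A division of an interval $I$ is a finite set of pairwise non-overlapping intervals (with arbitrary choice of end-point brackets for each) the union of whose closures is the closure of $I$; its norm is the greatest length of its intervals. $G_1$ is the set of all divisions. For an interval function $h$ and an interval $I$ in $W$, $(N;G_1)\overline{\int}_I h=\lim_{e\to0}\sup\{\sum_{J\in D}h(J):D\text{ a division of }I,\ \mathrm{norm}(D)<e\}$, $(N;G_1)\underline{\int}_I h$ is the same with $\inf$, and the norm-limit $(N;G_1)\int_I h$ exists if these are finite and equal, and is then their common value. For measurable $E\subset W$ put $K(I)=\dfrac{g(I)\,m(E\cap I)}{mI}$; the upper and lower density integrals are $(D;G_1)\overline{\int}_E g(I)=(N;G_1)\overline{\int}_W K(I)$ and $(D;G_1)\underline{\int}_E g(I)=(N;G_1)\underline{\int}_W K(I)$. An interval function $N$ is absolutely continuous in $W$ if for every $\varepsilon>0$ there is $\delta>0$ such that $|\sum N(I)|<\varepsilon$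 for every finite set of pairwise non-overlapping intervals $I$ in $W$ with total length less than $\delta$. *)

(* Defs.v *)
From HB Require Import structures.
From mathcomp Require Import all_boot all_order all_algebra finmap.
From mathcomp Require Import all_classical all_reals all_analysis.

Set Implicit Arguments.
Unset Strict Implicit.
Unset Printing Implicit Defensive.

Import Order.TTheory GRing.Theory Num.Theory.
Import numFieldNormedType.Exports.

Local Open Scope classical_set_scope.
Local Open Scope ring_scope.

(* An interval function is a total function on [interval R]; only its values at
   the non-degenerate bounded intervals contained in [A, B] are ever used. *)

Definition nondegenerate_itv (R : realType) (I : interval R) : bool :=
  match I with
  | Interval (BSide _ a) (BSide _ b) => a < b
  | _ => false
  end.

(* The two booleans are the end-point brackets, so all four kinds of interval
   with end-points A <= a < b <= B are covered. *)
Definition interval_in (R : realType) (A B : R) (I : interval R) : bool :=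
  match I with
  | Interval (BSide _ a) (BSide _ b) => [&& A <= a, a < b & b <= B]
  | _ => false
  end.

Definition itv_length (R : realType) (I : interval R) : R :=
  match I with
  | Interval (BSide _ a) (BSide _ b) => b - a
  | _ => 0
  end.

Definition overlap (R : realType) (I J : interval R) : Prop :=
  exists K : interval R,
    nondegenerate_itv K /\ [set` K] `<=` [set` I] `&` [set` J].

Definition non_overlapping (R : realType) (D : {fset interval R}) : Prop :=
  forall I J : interval R, I \in D -> J \in D -> I != J -> ~ overlap I J.

Definition division (R : realType) (I : interval R) (D : {fset interval R})
    : Prop :=
  [/\ forall J : interval R, J \in D -> nondegenerate_itv J,
      non_overlapping D
    & \bigcup_(J in [set` D]) closure [set` J] = closure [set` I]].

Definition division_norm (R : realType) (D : {fset interval R}) : R :=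
  \big[Num.max/0]_(J <- D) itv_length J.

Definition division_sums (R : realType) (h : interval R -> R) (I : interval R)
    (e : R) : set (\bar R) :=
  [set (\sum_(J <- D) h J)%:E
     | D in [set D : {fset interval R} | division I D /\ division_norm D < e]].

(* The limits below always exist in \bar R, by monotonicity in e. *)
Definition upper_norm_integral (R : realType) (h : interval R -> R)
    (I : interval R) : \bar R :=
  lim (ereal_sup (division_sums h I e) @[e --> 0^'+]).

Definition lower_norm_integral (R : realType) (h : interval R -> R)
    (I : interval R) : \bar R :=
  lim (ereal_inf (division_sums h I e) @[e --> 0^'+]).

Definition finite_and_equal (R : realType) (x y : \bar R) : Prop :=
  [/\ x \is a fin_num, y \is a fin_num & x = y].

Definition norm_limit_exists (R : realType) (h : interval R -> R)
    (I : interval R) : Prop :=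
  finite_and_equal (upper_norm_integral h I) (lower_norm_integral h I).

(* The norm-limit of h over I, meaningful when [norm_limit_exists h I]. *)
Definition norm_limit (R : realType) (h : interval R -> R) (I : interval R)
    : R :=
  fine (upper_norm_integral h I).

(* Lebesgue measurability proper (Caratheodory measurability for Lebesgue outer
   measure), as opposed to Borel measurability. *)
Definition lebesgue_measurable (R : realType) (E : set R) : Prop :=
  (@wlength R idfun)^*%mu.-cara.-measurable E.

Definition density_fun (R : realType) (g : interval R -> R) (E : set R)
    (I : interval R) : R :=
  g I * fine (completed_lebesgue_measure (E `&` [set` I])) / itv_length I.

Definition upper_density_integral (R : realType) (A B : R)
    (g : interval R -> R) (E : set R) : \bar R :=
  upper_norm_integral (density_fun g E) `[A, B].

Definition lower_density_integral (R : realType) (A B : R)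
    (g : interval R -> R) (E : set R) : \bar R :=
  lower_norm_integral (density_fun g E) `[A, B].

Definition ac_interval_function (R : realType) (A B : R)
    (N : interval R -> R) : Prop :=
  forall eps : R, 0 < eps -> exists2 delta : R, 0 < delta &
    forall D : {fset interval R},
      (forall I : interval R, I \in D -> interval_in A B I) ->
      non_overlapping D ->
      \sum_(I <- D) itv_length I < delta ->
      `|\sum_(I <- D) N I| < eps.

(* Main.v *)
Require Import Defs.
From HB Require Import structures.
From mathcomp Require Import all_boot all_order all_algebra finmap.
From mathcomp Require Import all_classical all_reals all_analysis.
From mathcomp Require Import lra.

Set Implicit Arguments.
Unset Strict Implicit.
Unset Printing Implicit Defensive.

Import Order.TTheory GRing.Theory Num.Theory.
Import numFieldNormedType.Exports.

Local Open Scope classical_set_scope.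
Local Open Scope ring_scope.

(** For a division [D] and a measurable set [E] let S(D, E) be the sum over the
members J of [D] of g(J) m(E /\ J) / m(J). As a function of [E] this is a signed
measure whose density with respect to Lebesgue measure is a step function. Both
the density integral of [E] and the norm-limit of [g] exist exactly when the
corresponding sums satisfy a Cauchy condition as the norm of the division tends
to 0 ([Cauchy_sums_norm_limit], [norm_limit_sums_tend_to]), so the theorem
compares Cauchy conditions. The combinatorial tool throughout is that every
finite non-overlapping family extends to a division by adding arbitrarily short
intervals ([extend_to_subdivision]) and that members of a division can be
subdivided further ([subdivides_refine]).

Necessity. The set E = [A, B] gives the norm-limit over [A, B]; a division of a
subinterval extends to [A, B] by the same short intervals for all divisions, so
the norm-limit exists over every subinterval. Absolute continuity is an instance
of the Vitali-Hahn-Saks phenomenon, and is proved by a gliding hump. If it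
fails, there are arbitrarily fine divisions [D] and arbitrarily small sets [U]
with |S(D, U)| bounded away from 0 ([concentrated_density]). Sets E_k are built
by adding or removing such humps, choosing at each step the alternative that
moves the density sum by a fixed amount, while later humps are so small that
they hardly affect the density sums already reached. The lower limit of the E_k
is then a measurable set whose density sums are not Cauchy
([hump_limit_not_Cauchy]).

Sufficiency. Henstock's lemma ([henstock]) carries the absolute continuity of
the norm-limit over to [g] on fine families, and this bounds the sum of |g(J)|
over fine divisions ([bounded_variation]). Together they show that a set of
small measure contributes little to S(D, E), uniformly in the fine division [D]
([density_small]). For an interval [E] only the members of [D] that contain an
end-point in their interior matter for the difference between S(D, E) and a sum
for the norm-limit over [E] ([interval_tends_to]); inclusion-exclusion gives the
Cauchy property for finite unions of intervals ([Cauchy_finite_union]), and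
these approximate every measurable set in measure
([approx_by_half_open]). *)

(** * End-points, separation and divisions *)

Section IntervalEndpoints.
Variable R : realType.
Implicit Types (I J K : interval R) (D P Q : {fset interval R}) (a b t e : R).

Definition lo I : R := if I is Interval (BSide _ a) _ then a else 0.
Definition hi I : R := if I is Interval _ (BSide _ b) then b else 0.

Lemma nondegenerate_lo_hi I : nondegenerate_itv I -> lo I < hi I.
Proof. by case: I => [[? ?|?] [? ?|?]]. Qed.

Lemma itv_lengthE I : nondegenerate_itv I -> itv_length I = hi I - lo I.
Proof. by case: I => [[? ?|?] [? ?|?]]. Qed.

Lemma itv_length_gt0 I : nondegenerate_itv I -> 0 < itv_length I.
Proof. by move=> nI; rewrite itv_lengthE// subr_gt0 nondegenerate_lo_hi. Qed.

Lemma interval_inE a b I :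
  interval_in a b I <-> [/\ nondegenerate_itv I, a <= lo I & hi I <= b].
Proof.
case: I => [[? ?|?] [? ?|?]] /=; split=> //; try by case.
  by case/and3P.
by case=> -> -> ->.
Qed.

Lemma nondegenerate_mem_ge I t :
  nondegenerate_itv I -> t \in I -> lo I <= t <= hi I.
Proof.
case: I => [[[] a|?] [[] b|?]] //= _; rewrite in_itv/= => /andP[h1 h2];
  by rewrite ?h1 ?h2 ?(ltW h1) ?(ltW h2).
Qed.

Lemma nondegenerate_mem_interior I t :
  nondegenerate_itv I -> lo I < t < hi I -> t \in I.
Proof.
case: I => [[[] a|?] [[] b|?]] //= _ /andP[h1 h2]; rewrite in_itv/=;
  by rewrite ?h1 ?h2 ?(ltW h1) ?(ltW h2).
Qed.

(** The interior is a ball, and the closure of a ball is the closed ball. *)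
Lemma closure_nondegenerate I :
  nondegenerate_itv I -> closure [set` I] = [set` `[lo I, hi I]].
Proof.
move=> nI; have ltI := nondegenerate_lo_hi nI; apply/seteqP; split.
  have /closure_id -> : closed [set` `[lo I, hi I]] by exact: interval_closed.
  apply: closureS => t /= tI; rewrite in_itv/=.
  exact: nondegenerate_mem_ge.
pose c := (lo I + hi I) / 2; pose r := (hi I - lo I) / 2.
have r0 : 0 < r by rewrite divr_gt0// subr_gt0.
have ballI : ball c r `<=` [set` I].
  move=> t; rewrite /ball/= => ht; apply: nondegenerate_mem_interior => //.
  by move: ht; rewrite ltr_norml /c /r => /andP[h1 h2]; apply/andP; split; lra.
apply: subset_trans (closureS ballI); rewrite closure_ballE closed_ballE//.
move=> t /=; rewrite in_itv /closed_ball_ /= => /andP[h1 h2].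
by rewrite ler_norml /c /r; apply/andP; split; lra.
Qed.

(** Non-overlapping of non-degenerate intervals, expressed by end-points
([separatedP]). *)
Definition separated I J := (hi I <= lo J) || (hi J <= lo I).

Lemma separatedC I J : separated I J = separated J I.
Proof. by rewrite /separated orbC. Qed.

Lemma not_separated_self I : nondegenerate_itv I -> separated I I = false.
Proof.
by move/nondegenerate_lo_hi => h; rewrite /separated orbb leNgt h.
Qed.

Lemma not_separatedP I J :
  ~~ separated I J = (lo J < hi I) && (lo I < hi J).
Proof. by rewrite /separated negb_or -!ltNge. Qed.

Lemma separatedP I J : nondegenerate_itv I -> nondegenerate_itv J ->
  ~ overlap I J <-> separated I J.
Proof.
move=> nI nJ; split.
  move=> h; apply: contrapT => /negP; rewrite not_separatedP => /andP[h1 h2].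
  apply: h; exists `]Num.max (lo I) (lo J), Num.min (hi I) (hi J)[.
  split.
    rewrite /= lt_min !gt_max h1 h2.
    by rewrite (nondegenerate_lo_hi nI) (nondegenerate_lo_hi nJ).
  move=> t /=; rewrite in_itv/= gt_max lt_min.
  move=> /andP[/andP[t1 t2] /andP[t3 t4]].
  by split; apply: nondegenerate_mem_interior => //; rewrite ?t1 ?t2 ?t3 ?t4.
move=> sIJ [K [nK subK]].
have ltK := nondegenerate_lo_hi nK.
have mid u : lo K < u < hi K ->
    lo I <= u /\ u <= hi I /\ lo J <= u /\ u <= hi J.
  move=> hu; have [/= uI uJ] := subK u (nondegenerate_mem_interior nK hu).
  have /andP[? ?] := nondegenerate_mem_ge nI uI.
  by have /andP[? ?] := nondegenerate_mem_ge nJ uJ.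
have /mid[? [? [? ?]]] : lo K < lo K + (hi K - lo K) / 3 < hi K.
  by apply/andP; split; lra.
have /mid[? [? [? ?]]] : lo K < lo K + (hi K - lo K) / 2 < hi K.
  by apply/andP; split; lra.
by case/orP: sIJ => ?; lra.
Qed.

Definition separated_family D := forall J K : interval R,
  J \in D -> K \in D -> J != K -> separated J K.

Lemma non_overlappingP D : (forall J, J \in D -> nondegenerate_itv J) ->
  non_overlapping D <-> separated_family D.
Proof.
by move=> nD; split=> h J K JD KD JK; apply/separatedP;
  rewrite ?nD//; exact: h.
Qed.

(** The divisions of an interval with end-points [a] and [b], with overlaps and
closures translated into inequalities between end-points ([divisionE]). *)
Record subdivides a b D : Prop := Subdivides {
  subdivides_nondegenerate : forall J, J \in D -> nondegenerate_itv J;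
  subdivides_separated : separated_family D;
  subdivides_lo : forall J, J \in D -> a <= lo J;
  subdivides_hi : forall J, J \in D -> hi J <= b;
  subdivides_cover : forall t, a <= t -> t <= b ->
    exists J, [/\ J \in D, lo J <= t & t <= hi J] }.

Lemma divisionE I D : nondegenerate_itv I ->
  division I D <-> subdivides (lo I) (hi I) D.
Proof.
move=> nI; rewrite /division closure_nondegenerate//.
have mem_bigcup t : (forall J, J \in D -> nondegenerate_itv J) ->
    (\bigcup_(J in [set` D]) closure [set` J]) t <->
    exists J, [/\ J \in D, lo J <= t & t <= hi J].
  move=> nD; split.
    move=> [J /= JD]; rewrite closure_nondegenerate ?nD//= in_itv/=.
    by move=> /andP[? ?]; exists J.
  move=> [J [JD h1 h2]]; exists J => //=.
  by rewrite closure_nondegenerate ?nD//= in_itv/= h1 h2.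
split.
  move=> [nD /(non_overlappingP nD) sD cD].
  have inI J t : J \in D -> lo J <= t -> t <= hi J -> lo I <= t <= hi I.
    move=> JD h1 h2; have : [set` `[lo I, hi I]] t.
      by rewrite -cD; apply/mem_bigcup => //; exists J.
    by rewrite /= in_itv.
  split=> //.
  - by move=> J JD; have /andP[] := inI J (lo J) JD (lexx _)
      (ltW (nondegenerate_lo_hi (nD _ JD))).
  - by move=> J JD; have /andP[] := inI J (hi J) JD
      (ltW (nondegenerate_lo_hi (nD _ JD))) (lexx _).
  - by move=> t h1 h2; apply/mem_bigcup => //; rewrite cD /= in_itv/= h1 h2.
move=> [nD sD lD hD cD]; split=> //; first exact/non_overlappingP.
apply/seteqP; split=> t /=.
  move=> /(mem_bigcup _ nD)[J [JD h1 h2]]; rewrite in_itv/=.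
  by rewrite (le_trans (lD _ JD) h1) (le_trans h2 (hD _ JD)).
by rewrite in_itv/= => /andP[h1 h2]; apply/mem_bigcup => //; exact: cD.
Qed.

Definition fine_family e D := forall J, J \in D -> itv_length J < e.

Lemma division_normP D e : division_norm D < e <-> 0 < e /\ fine_family e D.
Proof.
rewrite /division_norm /fine_family; split.
  move=> h; split.
    by apply: le_lt_trans h; exact: bigmax_ge_id.
  by move=> J JD; apply: le_lt_trans h; exact: le_bigmax_seq.
move=> [e0 h]; rewrite big_seq; elim/big_ind: _ => // x y xe ye.
by rewrite gt_max xe ye.
Qed.

End IntervalEndpoints.

(** * Extending and refining divisions *)

Section Gluing.
Variable R : realType.
Implicit Types (I J K : interval R) (D P Q : {fset interval R}).
Implicit Types (a b t e : R) (X : seq R) (h : interval R -> R).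

Lemma big_fsetU_disjoint D P h : [disjoint D & P]%fset ->
  \sum_(J <- (D `|` P)%fset) h J = \sum_(J <- D) h J + \sum_(J <- P) h J.
Proof.
move=> /fdisjointP dDP; rewrite (big_fsetID _ (mem D)) /=; congr (_ + _).
  by apply: eq_fbigl => J; rewrite !inE /=; case: (J \in D); rewrite ?andbF.
apply: eq_fbigl => J; rewrite !inE /=.
by have := dDP J; case: (J \in D) => [/(_ isT)/negPf ->|_]; rewrite ?andbT.
Qed.

(** The closed intervals between consecutive points of [X]. *)
Definition atoms X : {fset interval R} :=
  seq_fset tt [seq `[p.1, p.2] | p <- [seq (x, y) | x <- X, y <- X]
    & (p.1 < p.2) && all (fun z => (z <= p.1) || (p.2 <= z)) X].

Lemma atomsP X J : reflect
  (exists x y, [/\ x \in X, y \in X, x < y,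
     forall z, z \in X -> (z <= x) || (y <= z) & J = `[x, y]])
  (J \in atoms X).
Proof.
rewrite seq_fsetE; apply: (iffP mapP).
  move=> [[x y]]; rewrite mem_filter /= => /andP[/andP[xy /allP XP]].
  by case/allpairsP => [[x' y'] [/= ? ? [? ?]]] ->; subst; exists x', y'.
move=> [x [y [xX yX xy XP ->]]]; exists (x, y) => //.
rewrite mem_filter /= xy /=; apply/andP; split; first exact/allP.
by apply/allpairsP; exists (x, y).
Qed.

(** Among the pairs of points of [X] that bracket [t] there is one with no
point of a prescribed list strictly inside: each point of the list that falls
inside replaces one of the two ends. *)
Lemma atoms_cover X a b t : a \in X -> b \in X -> a < b -> a <= t <= b ->
  exists J, [/\ J \in atoms X, lo J <= t & t <= hi J].
Proof.
move=> aX bX ab /andP[at_ tb].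
suff [x [y [xX yX xy xt [ty XP]]]] : exists x y, [/\ x \in X, y \in X, x < y,
    x <= t & t <= y /\ forall z, z \in X -> (z <= x) || (y <= z)].
  by exists `[x, y]; split=> //=; apply/atomsP; exists x, y.
have : {subset X <= X} by [].
move: {1 5}X => s; elim: s => [|z s IH] sX.
  by exists a, b; split=> //; split.
have [|x [y [xX yX xy xt [ty sP]]]] := IH.
  by move=> u us; apply: sX; rewrite inE us orbT.
have zX : z \in X by apply: sX; rewrite inE eqxx.
have [zx|xz] := leP z x.
  exists x, y; split=> //; split=> // u; rewrite inE => /predU1P[->|/sP//].
  by rewrite zx.
have [yz|zy] := leP y z.
  exists x, y; split=> //; split=> // u; rewrite inE => /predU1P[->|/sP//].
  by rewrite yz orbT.
have [tz|zt] := leP t z.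
  exists x, z; split=> //; split=> // u; rewrite inE => /predU1P[->|/sP].
    by rewrite lexx orbT.
  by case/orP => [->//|yu]; rewrite (le_trans (ltW zy) yu) orbT.
exists z, y; split=> //; first exact: ltW.
split=> // u; rewrite inE => /predU1P[->|/sP].
  by rewrite lexx.
by case/orP => [ux|->]; rewrite ?orbT// (le_trans ux (ltW xz)).
Qed.

(** An interval longer than the mesh with no grid point inside would, by
induction along the grid, lie to the right of all grid points, including [b]. *)
Lemma exists_fine_grid a b e : a < b -> 0 < e ->
  exists s : seq R, (forall z, z \in s -> a <= z <= b) /\
    forall x y, a <= x -> x < y -> y <= b ->
      (forall z, z \in s -> (z <= x) || (y <= z)) -> y - x < e.
Proof.
move=> ab e0; pose n := Num.bound ((b - a) / e).
have n_gt : (b - a) / e < n%:R.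
  by apply: archi_boundP; rewrite divr_ge0 ?subr_ge0// ltW.
have n0 : 0 < n%:R :> R.
  by apply: le_lt_trans n_gt; rewrite divr_ge0 ?subr_ge0// ltW.
pose r := (b - a) / n%:R.
have r0 : 0 <= r by rewrite divr_ge0 ?subr_ge0// ltW.
have re : r < e.
  by rewrite /r ltr_pdivrMr// mulrC -ltr_pdivrMr.
have nr : a + n%:R * r = b.
  by rewrite /r mulrC divfK ?gt_eqF// addrC subrK.
exists [seq a + k%:R * r | k <- iota 0 n.+1]; split.
  move=> z /mapP[k]; rewrite mem_iota add0n ltnS /= => kn ->.
  by rewrite lerDl mulr_ge0//= -nr lerD2l ler_wpM2r// ler_nat.
move=> x y ax xy yb sP; apply: contrapT => /negP; rewrite -leNgt => eyx.
suff /(_ n (leqnn _)) : forall k, (k <= n)%N -> a + k%:R * r <= x.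
  by rewrite nr => bx; move: (lt_le_trans xy yb); rewrite ltNge bx.
elim=> [|k IH] kn; first by rewrite mul0r addr0.
have {}IH := IH (ltnW kn).
have /sP/orP[//|yk] : a + k.+1%:R * r \in [seq a + k%:R * r | k <- iota 0 n.+1].
  by apply/mapP; exists k.+1; rewrite // mem_iota add0n ltnS.
by move: yk; rewrite -natr1 mulrDl mul1r => yk; exfalso; lra.
Qed.

(** The gaps of a separated family can be filled by arbitrarily short
intervals: cut along all its end-points and a fine grid, and keep the atoms
that no member of the family overlaps. *)
Lemma extend_to_subdivision a b P e : a < b -> 0 < e ->
  (forall J, J \in P -> interval_in a b J) -> separated_family P ->
  exists Q, [/\ fine_family e Q, [disjoint P & Q]%fset &
    subdivides a b (P `|` Q)%fset].
Proof.
move=> ab e0 PW sP; have [s [sab s_fine]] := exists_fine_grid ab e0.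
pose X := [:: a, b & s ++ map (@lo R) P ++ map (@hi R) P].
have aX : a \in X by rewrite inE eqxx.
have bX : b \in X by rewrite !inE eqxx orbT.
have X_ab z : z \in X -> a <= z <= b.
  rewrite !inE !mem_cat => /or3P[/eqP->|/eqP->|/or3P[/sab//||]].
  - by rewrite lexx ltW.
  - by rewrite lexx ltW.
  - move=> /mapP[J JP ->]; have /interval_inE[nJ ? ?] := PW _ JP.
    apply/andP; split=> //; apply: le_trans (ltW (nondegenerate_lo_hi nJ)) _.
    by [].
  - move=> /mapP[J JP ->]; have /interval_inE[nJ ? ?] := PW _ JP.
    apply/andP; split=> //.
    by apply: le_trans (ltW (nondegenerate_lo_hi nJ)).
have PX J : J \in P -> lo J \in X /\ hi J \in X.
  move=> JP; rewrite !inE !mem_cat; split.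
    by rewrite (map_f (@lo R) JP) !orbT.
  by rewrite (map_f (@hi R) JP) !orbT.
pose Q := [fset J in atoms X | all (separated J) P]%fset.
have QP J : J \in Q -> [/\ J \in atoms X & forall I, I \in P -> separated J I].
  by rewrite !inE /= => /andP[-> /allP].
have PnQ J : J \in P -> J \in Q -> False.
  move=> JP /QP[_ /(_ _ JP)].
  by have /interval_inE[nJ _ _] := PW _ JP; rewrite not_separated_self.
have nP J : J \in P -> nondegenerate_itv J by move=> /PW/interval_inE[].
have nA J : J \in atoms X -> nondegenerate_itv J.
  by move=> /atomsP[x [y [_ _ xy _ ->]]].
have sA J K : J \in atoms X -> K \in atoms X -> J != K -> separated J K.
  move=> /atomsP[x [y [xX yX xy xyP ->]]] /atomsP[u [v [uX vX uv uvP ->]]].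
  rewrite /separated /=; case: (leP y u) => //= uy; case: (leP v x) => //= xv.
  have ux : u <= x by case/orP: (xyP _ uX) => //; rewrite leNgt uy.
  have xu : x <= u by case/orP: (uvP _ xX) => //; rewrite leNgt xv.
  have vy : y <= v by case/orP: (xyP _ vX) => //; rewrite leNgt xv.
  have yv : v <= y by case/orP: (uvP _ yX) => //; rewrite leNgt uy.
  have -> : x = u by apply/eqP; rewrite eq_le xu ux.
  have -> : y = v by apply/eqP; rewrite eq_le vy yv.
  by rewrite eqxx.
exists Q; split.
- move=> J /QP[/atomsP[x [y [/X_ab/andP[? _] /X_ab/andP[_ ?] xy XP ->]]] _] /=.
  by apply: s_fine => // z zs; apply: XP; rewrite !inE !mem_cat zs !orbT.
- by apply/fdisjointP => J JP; apply/negP; exact: PnQ.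
- split.
  + by move=> J; rewrite in_fsetU => /orP[/nP//|/QP[/nA]].
  + move=> J K; rewrite !in_fsetU => /orP[JP|JQ] /orP[KP|KQ] JK.
    * exact: sP.
    * by rewrite separatedC; have [_] := QP _ KQ; apply.
    * by have [_] := QP _ JQ; apply.
    * by have [JA _] := QP _ JQ; have [KA _] := QP _ KQ; exact: sA.
  + move=> J; rewrite in_fsetU => /orP[/PW/interval_inE[]//|/QP[/atomsP[x [y]]]].
    by case=> /X_ab/andP[? _] _ _ _ ->.
  + move=> J; rewrite in_fsetU => /orP[/PW/interval_inE[]//|/QP[/atomsP[x [y]]]].
    by case=> _ /X_ab/andP[_ ?] _ _ ->.
  move=> t ta tb.
  have [|J [JA lJ hJ]] := @atoms_cover X a b t aX bX ab; first by rewrite ta tb.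
  have [JP|/allPn[I IP]] := boolP (all (separated J) P).
    by exists J; split=> //; rewrite !inE JA JP orbT.
  rewrite not_separatedP => /andP[h1 h2]; exists I.
  move: JA lJ hJ h1 h2 => /atomsP[x [y [_ _ _ XP ->]]] /= lJ hJ h1 h2.
  have [loX hiX] := PX _ IP; rewrite inE IP; split=> //.
  + apply: le_trans lJ; case/orP: (XP _ loX) => //.
    by rewrite leNgt h1.
  + apply: (le_trans hJ); case/orP: (XP _ hiX) => //.
    by rewrite leNgt h2.
Qed.

Lemma exists_fine_subdivision a b e : a < b -> 0 < e ->
  exists D, fine_family e D /\ subdivides a b D.
Proof.
move=> ab e0.
have [//|//|Q [fQ _]] := @extend_to_subdivision a b fset0 e ab e0.
by rewrite fset0U => sQ; exists Q.
Qed.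

(** Members of different [F I] lie in different members of [P], so they are
non-overlapping, in particular distinct: sums over the refinement split. *)
Lemma subdivides_refine a b P Q (F : interval R -> {fset interval R}) :
  subdivides a b (P `|` Q)%fset -> [disjoint P & Q]%fset ->
  (forall I, I \in P -> subdivides (lo I) (hi I) (F I)) ->
  let D := (\bigcup_(I <- P) F I)%fset in
  [/\ subdivides a b (D `|` Q)%fset, [disjoint D & Q]%fset
    & forall h, \sum_(J <- D) h J = \sum_(I <- P) \sum_(J <- F I) h J].
Proof.
move=> [nPQ sPQ lPQ hPQ cPQ] dPQ sF /=; set D := (X in (X `|` _)%fset).
have DP J : J \in D -> exists I, I \in P /\ J \in F I.
  by move=> /bigfcupP[I /andP[IP _] JF]; exists I.
have PD I J : I \in P -> J \in F I -> J \in D.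
  by move=> IP JF; apply/bigfcupP; exists I; rewrite ?IP.
have PU I : I \in P -> I \in (P `|` Q)%fset by rewrite inE => ->.
have QU I : I \in Q -> I \in (P `|` Q)%fset by rewrite inE orbC => ->.
have sepl I J K : I \in P -> J \in F I -> separated I K -> separated J K.
  move=> IP JF; rewrite /separated.
  have := subdivides_lo (sF _ IP) JF; have := subdivides_hi (sF _ IP) JF.
  by move=> h1 h2 /orP[h|h]; apply/orP; [left|right]; lra.
have sepr I J K : I \in P -> J \in F I -> separated K I -> separated K J.
  by rewrite ![separated K _]separatedC; exact: sepl.
have nF I J : I \in P -> J \in F I -> nondegenerate_itv J.
  by move=> /sF/subdivides_nondegenerate; apply.
have sDQ J K : J \in D -> K \in Q -> separated J K.
  move=> /DP[I [IP JF]] KQ; apply: sepl (IP) (JF) _.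
  apply: sPQ; [exact: PU|exact: QU|].
  by apply: contraTneq KQ => <-; move/fdisjointP : dPQ; apply.
have nJF I K J : I \in P -> K \in P -> I != K -> J \in F I -> J \in F K -> False.
  move=> IP KP IK JI JK.
  have : separated J J.
    by apply: sepl (IP) (JI) _; apply: sepr (KP) (JK) _;
      apply: sPQ => //; exact: PU.
  by rewrite not_separated_self// (nF I).
split; last first.
- move=> h; apply: partition_disjoint_bigfcup => I K IP KP IK.
  by apply/fdisjointP => J JI; apply/negP => JK; exact: (nJF I K J).
- apply/fdisjointP => J JD; apply/negP => JQ; have := sDQ _ _ JD JQ.
  by rewrite not_separated_self// nPQ// QU.
split.
- move=> J; rewrite in_fsetU => /orP[/DP[I [IP JF]]|JQ]; first exact: nF JF.
  by apply: nPQ; exact: QU.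
- move=> J K; rewrite !in_fsetU => /orP[JD|JQ] /orP[KD|KQ] JK.
  + have [I [IP JI]] := DP _ JD; have [L [LP KL]] := DP _ KD.
    have [IL|IL] := eqVneq I L.
      by apply: (subdivides_separated (sF _ IP)) => //; rewrite IL.
    apply: sepl (IP) (JI) _; apply: sepr (LP) (KL) _.
    by apply: sPQ => //; exact: PU.
  + exact: sDQ.
  + by rewrite separatedC; exact: sDQ.
  + by apply: sPQ => //; exact: QU.
- move=> J; rewrite in_fsetU => /orP[/DP[I [IP JF]]|JQ]; last exact: lPQ (QU _ JQ).
  by apply: le_trans (lPQ _ (PU _ IP)) _; exact: subdivides_lo (sF _ IP) _ _.
- move=> J; rewrite in_fsetU => /orP[/DP[I [IP JF]]|JQ]; last exact: hPQ (QU _ JQ).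
  by apply: le_trans (hPQ _ (PU _ IP)); exact: subdivides_hi (sF _ IP) _ _.
move=> t ta tb; have [I []] := cPQ t ta tb; rewrite inE => /orP[IP|IQ] lI hI.
  have [J [JF lJ hJ]] := subdivides_cover (sF _ IP) lI hI.
  by exists J; rewrite inE (PD I).
by exists I; rewrite inE IQ orbT.
Qed.

Lemma fine_familyU e D P : fine_family e D -> fine_family e P ->
  fine_family e (D `|` P)%fset.
Proof. by move=> fD fP J; rewrite inE => /orP[/fD|/fP]. Qed.

Lemma fine_family_bigcup e P (F : interval R -> {fset interval R}) :
  (forall I, I \in P -> fine_family e (F I)) ->
  fine_family e (\bigcup_(I <- P) F I)%fset.
Proof. by move=> fF J /bigfcupP[I /andP[IP _] JF]; exact: fF JF. Qed.

Lemma fine_familyW e e' D : e <= e' -> fine_family e D -> fine_family e' D.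
Proof. by move=> ee' fD J JD; exact: lt_le_trans (fD _ JD) ee'. Qed.

End Gluing.

(** * Norm-limits as Cauchy conditions *)

Section NormLimits.
Variable R : realType.
Implicit Types (I J K : interval R) (D P Q : {fset interval R}).
Implicit Types (a b e : R) (h : interval R -> R).

Definition Cauchy_sums h a b := forall eps : R, 0 < eps ->
  exists2 eta : R, 0 < eta & forall D D',
    subdivides a b D -> fine_family eta D ->
    subdivides a b D' -> fine_family eta D' ->
    `|\sum_(J <- D) h J - \sum_(J <- D') h J| <= eps.

Definition sums_tend_to h a b (l : R) := forall eps : R, 0 < eps ->
  exists2 eta : R, 0 < eta & forall D,
    subdivides a b D -> fine_family eta D -> `|\sum_(J <- D) h J - l| <= eps.

Lemma sums_tend_to_Cauchy h a b l : sums_tend_to h a b l -> Cauchy_sums h a b.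
Proof.
move=> hl eps eps0; have [|eta eta0 H] := hl (eps / 2); first by rewrite divr_gt0.
exists eta => // D D' sD fD sD' fD'.
have := H _ sD fD; have := H _ sD' fD'; rewrite !ler_norml.
by move=> /andP[? ?] /andP[? ?]; apply/andP; split; lra.
Qed.

Section OneInterval.
Variables (I : interval R) (h : interval R -> R).
Hypothesis nI : nondegenerate_itv I.

Let sums e := division_sums h I e.

Lemma mem_division_sums e D : 0 < e -> subdivides (lo I) (hi I) D ->
  fine_family e D -> sums e (\sum_(J <- D) h J)%:E.
Proof.
move=> e0 sD fD; exists D => //; split; first exact/divisionE.
exact/division_normP.
Qed.

Lemma division_sumsP e x : sums e x -> exists D,
  [/\ subdivides (lo I) (hi I) D, fine_family e D & x = (\sum_(J <- D) h J)%:E].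
Proof.
move=> [D [/(divisionE _ nI) sD /division_normP[_ fD]] Dx].
by exists D.
Qed.

Lemma division_sumsS e e' : e <= e' -> sums e `<=` sums e'.
Proof.
move=> ee' x [D [dD nD] Dx]; exists D => //; split=> //.
exact: lt_le_trans ee'.
Qed.

Lemma upper_norm_integralE :
  upper_norm_integral h I = ereal_inf [set ereal_sup (sums e) | e in `]0, +oo[].
Proof.
apply: cvg_lim => //; apply: nondecreasing_at_right_cvge => // x y _ _ xy.
by apply: ereal_sup_le; exact: division_sumsS.
Qed.

Lemma lower_norm_integralE :
  lower_norm_integral h I = ereal_sup [set ereal_inf (sums e) | e in `]0, +oo[].
Proof.
apply: cvg_lim => //; apply: nonincreasing_at_right_cvge => // x y _ _ xy.
by apply: ereal_inf_le_tmp; exact: division_sumsS.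
Qed.

Lemma lower_le_upper_norm_integral :
  (lower_norm_integral h I <= upper_norm_integral h I)%E.
Proof.
rewrite upper_norm_integralE lower_norm_integralE.
apply: ge_ereal_sup => x [e /=]; rewrite in_itv/= andbT => e0 <-.
apply: le_ereal_inf_tmp => y [e' /=]; rewrite in_itv/= andbT => e'0 <-.
have m0 : 0 < Num.min e e' by rewrite lt_min e0.
have [D [fD sD]] := exists_fine_subdivision (nondegenerate_lo_hi nI) m0.
apply: (@le_trans _ _ (\sum_(J <- D) h J)%:E).
  apply: ereal_inf_lbound; apply: mem_division_sums => //.
  by apply: fine_familyW fD; rewrite ge_min lexx.
apply: ereal_sup_ubound; apply: mem_division_sums => //.
by apply: fine_familyW fD; rewrite ge_min lexx orbT.
Qed.

Lemma norm_limit_sums_tend_to : norm_limit_exists h I ->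
  sums_tend_to h (lo I) (hi I) (norm_limit h I).
Proof.
move=> [finU finL UL] eps eps0.
have UE : upper_norm_integral h I = (norm_limit h I)%:E by rewrite fineK.
have LE : lower_norm_integral h I = (norm_limit h I)%:E by rewrite -UL UE.
have : (upper_norm_integral h I < (norm_limit h I + eps)%:E)%E.
  by rewrite UE lte_fin ltrDl.
rewrite upper_norm_integralE.
move=> /ereal_inf_lt[x [e1 /=]]; rewrite in_itv/= andbT => e10 <- he1.
have : ((norm_limit h I - eps)%:E < lower_norm_integral h I)%E.
  by rewrite LE lte_fin ltrBlDr ltrDl.
rewrite lower_norm_integralE.
move=> /ereal_sup_gt[y [e2 /=]]; rewrite in_itv/= andbT => e20 <- he2.
exists (Num.min e1 e2); first by rewrite lt_min e10.
move=> D sD fD.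
have : ((\sum_(J <- D) h J)%:E < (norm_limit h I + eps)%:E)%E.
  apply: le_lt_trans he1; apply: ereal_sup_ubound.
  apply: mem_division_sums => //.
  by apply: fine_familyW fD; rewrite ge_min lexx.
have : ((norm_limit h I - eps)%:E < (\sum_(J <- D) h J)%:E)%E.
  apply: lt_le_trans he2 _; apply: ereal_inf_lbound.
  apply: mem_division_sums => //.
  by apply: fine_familyW fD; rewrite ge_min lexx orbT.
rewrite !lte_fin ler_norml => ? ?; apply/andP; split; lra.
Qed.

(** The sum over one fine division lies within [eps] of both the upper and the
lower limit, which are therefore finite and at distance at most [2 * eps]. *)
Lemma Cauchy_sums_norm_limit :
  Cauchy_sums h (lo I) (hi I) -> norm_limit_exists h I.
Proof.
move=> hC.
have bounds eps : 0 < eps -> exists s : R,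
    ((s - eps)%:E <= lower_norm_integral h I)%E /\
    (upper_norm_integral h I <= (s + eps)%:E)%E.
  move=> eps0; have [eta eta0 H] := hC _ eps0.
  have [D [fD sD]] := exists_fine_subdivision (nondegenerate_lo_hi nI) eta0.
  exists (\sum_(J <- D) h J); split.
    rewrite lower_norm_integralE.
    apply: (@le_trans _ _ (ereal_inf (sums eta))); last first.
      by apply: ereal_sup_ubound; exists eta => //=; rewrite in_itv/= eta0.
    apply: le_ereal_inf_tmp => _ /division_sumsP[D' [sD' fD' ->]].
    rewrite lee_fin; have := H _ _ sD fD sD' fD'; rewrite ler_norml.
    by move=> /andP[? ?]; lra.
  rewrite upper_norm_integralE.
  apply: (@le_trans _ _ (ereal_sup (sums eta))).
    by apply: ereal_inf_lbound; exists eta => //=; rewrite in_itv/= eta0.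
  apply: ge_ereal_sup => _ /division_sumsP[D' [sD' fD' ->]].
  rewrite lee_fin; have := H _ _ sD fD sD' fD'; rewrite ler_norml.
  by move=> /andP[? ?]; lra.
have LU := lower_le_upper_norm_integral.
have [s [sL sU]] := bounds 1 ltr01.
have finU : upper_norm_integral h I \is a fin_num.
  rewrite fin_numElt (le_lt_trans sU (ltry _)) andbT.
  exact: lt_le_trans (ltNyr _) (le_trans sL LU).
have finL : lower_norm_integral h I \is a fin_num.
  rewrite fin_numElt (lt_le_trans (ltNyr _) sL)/=.
  exact: le_lt_trans (le_trans LU sU) (ltry _).
split=> //; apply/eqP; rewrite eq_le LU andbT.
apply/lee_addgt0Pr => e e0.
have [|s' []] := bounds (e / 2); first by rewrite divr_gt0.
rewrite -(fineK finU) -(fineK finL) -EFinD !lee_fin.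
by move=> ? ?; lra.
Qed.

End OneInterval.

(** A division of a subinterval extends to one of the whole by adding the same
short intervals outside, so the sums over the subinterval inherit the Cauchy
property. *)
Lemma Cauchy_sums_sub a b I h : interval_in a b I ->
  Cauchy_sums h a b -> Cauchy_sums h (lo I) (hi I).
Proof.
move=> /[dup] IW /interval_inE[nI aI Ib] hC eps eps0.
have [eta eta0 H] := hC eps eps0.
exists eta => // D D' sD fD sD' fD'.
have ab : a < b by apply: le_lt_trans aI (lt_le_trans (nondegenerate_lo_hi nI) Ib).
have [||Q [fQ dQ sQ]] := @extend_to_subdivision _ a b [fset I]%fset eta ab eta0.
- by move=> J; rewrite inE => /eqP ->.
- by move=> J K; rewrite !inE => /eqP -> /eqP ->; rewrite eqxx.
have sub E : subdivides (lo I) (hi I) E -> subdivides a b (E `|` Q)%fset /\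
    \sum_(J <- (E `|` Q)%fset) h J = \sum_(J <- E) h J + \sum_(J <- Q) h J.
  move=> sE; have [|] := subdivides_refine (F := fun=> E) sQ dQ.
    by move=> J; rewrite inE => /eqP ->.
  by rewrite big_seq_fset1 => ? dE _; rewrite big_fsetU_disjoint.
have [[sDQ ED] [sDQ' ED']] := (sub _ sD, sub _ sD').
have := H _ _ sDQ (fine_familyU fD fQ) sDQ' (fine_familyU fD' fQ).
by rewrite ED ED' opprD addrACA subrr addr0.
Qed.

End NormLimits.

(** * Lebesgue measure of the part of a set in an interval *)

Section LebesgueParts.
Variable R : realType.
Implicit Types (I J K : interval R) (D P Q : {fset interval R}).
Implicit Types (a b e r : R) (E F V : set R).

Local Notation leb := (@completed_lebesgue_measure R).

Lemma lebesgue_measurable_itv J : lebesgue_measurable [set` J].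
Proof.
apply: sub_caratheodory; exact: measurable_itv.
Qed.

Lemma lebesgue_measurableI E F : lebesgue_measurable E ->
  lebesgue_measurable F -> lebesgue_measurable (E `&` F).
Proof. exact: measurableI. Qed.

Lemma lebesgue_measurableU E F : lebesgue_measurable E ->
  lebesgue_measurable F -> lebesgue_measurable (E `|` F).
Proof. exact: measurableU. Qed.

Lemma lebesgue_measurableD E F : lebesgue_measurable E ->
  lebesgue_measurable F -> lebesgue_measurable (E `\` F).
Proof. exact: measurableD. Qed.

Lemma lebesgue_measurable0 : lebesgue_measurable (@set0 R).
Proof. exact: measurable0. Qed.

Lemma lebesgue_measurable_bigcup (F : nat -> set R) :
  (forall n, lebesgue_measurable (F n)) ->
  lebesgue_measurable (\bigcup_n F n).
Proof. by move=> mF; apply: bigcupT_measurable. Qed.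

Lemma lebesgue_measurable_bigcap (F : nat -> set R) :
  (forall n, lebesgue_measurable (F n)) ->
  lebesgue_measurable (\bigcap_n F n).
Proof. by move=> mF; apply: bigcapT_measurable. Qed.

Lemma leb_le E F : lebesgue_measurable E -> lebesgue_measurable F ->
  E `<=` F -> (leb E <= leb F)%E.
Proof.
move=> mE mF EF; apply: (@le_measure _ _ _ leb) => //; apply/mem_set.
  exact: mE.
exact: mF.
Qed.

Lemma leb_itv J : nondegenerate_itv J -> leb [set` J] = (itv_length J)%:E.
Proof.
move=> nJ; have := nondegenerate_lo_hi nJ.
(* Both measures are restrictions of the same outer measure. *)
have -> : leb [set` J] = lebesgue_measure [set` J] by [].
rewrite lebesgue_measure_itv.
by case: J nJ => [[bl a|?] [br b|?]] //= _ ab; rewrite lte_fin ab EFinB.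
Qed.

Lemma leb_set1 a : leb [set a] = 0%E.
Proof.
have -> : leb [set a] = lebesgue_measure [set a] by [].
exact: lebesgue_measure_set1.
Qed.

Lemma leb_setU_le E F : lebesgue_measurable E -> lebesgue_measurable F ->
  (leb (E `|` F) <= leb E + leb F)%E.
Proof. by move=> mE mF; apply: measureU2; [exact: mE|exact: mF]. Qed.

Definition part E J : R := fine (leb (E `&` [set` J])).

Lemma part_bound E J : lebesgue_measurable E -> nondegenerate_itv J ->
  (leb (E `&` [set` J]) <= (itv_length J)%:E)%E.
Proof.
move=> mE nJ; rewrite -leb_itv//; apply: leb_le.
- by apply: lebesgue_measurableI => //; exact: lebesgue_measurable_itv.
- exact: lebesgue_measurable_itv.
- exact: subIsetr.
Qed.

Lemma partE E J : lebesgue_measurable E -> nondegenerate_itv J ->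
  leb (E `&` [set` J]) = (part E J)%:E.
Proof.
move=> mE nJ; rewrite /part fineK// ge0_fin_numE//.
by apply: le_lt_trans (part_bound mE nJ) _; rewrite ltry.
Qed.

Lemma part_ge0 E J : 0 <= part E J.
Proof. exact: fine_ge0. Qed.

Lemma part_le_length E J : lebesgue_measurable E -> nondegenerate_itv J ->
  part E J <= itv_length J.
Proof. by move=> mE nJ; rewrite -lee_fin -partE// part_bound. Qed.

Lemma part_le_leb V J r : lebesgue_measurable V -> nondegenerate_itv J ->
  (leb V <= r%:E)%E -> part V J <= r.
Proof.
move=> mV nJ Vr; rewrite -lee_fin -partE//; apply: le_trans Vr.
apply: leb_le; [|exact: mV|exact: subIsetl].
by apply: lebesgue_measurableI => //; exact: lebesgue_measurable_itv.
Qed.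

Lemma part_full E J : lebesgue_measurable E -> nondegenerate_itv J ->
  (forall t, lo J < t < hi J -> E t) -> part E J = itv_length J.
Proof.
move=> mE nJ EJ; apply/eqP; rewrite eq_le part_le_length//=.
rewrite -lee_fin -partE//.
have -> : itv_length J = itv_length `]lo J, hi J[ by rewrite itv_lengthE.
rewrite -leb_itv; last exact: nondegenerate_lo_hi.
apply: leb_le; first exact: lebesgue_measurable_itv.
  by apply: lebesgue_measurableI => //; exact: lebesgue_measurable_itv.
move=> t /=; rewrite in_itv/= => ht; split; first exact: EJ.
exact: nondegenerate_mem_interior.
Qed.

Lemma part_null E J p : lebesgue_measurable E -> nondegenerate_itv J ->
  (forall t, E t -> t \in J -> t = p) -> part E J = 0.
Proof.
move=> mE nJ EJ; apply/eqP; rewrite eq_le part_ge0 andbT.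
suff : (leb (E `&` [set` J]) <= leb [set p])%E by rewrite leb_set1 partE.
apply: leb_le.
- by apply: lebesgue_measurableI => //; exact: lebesgue_measurable_itv.
- by rewrite -set_itv1; exact: lebesgue_measurable_itv.
- by move=> t /= [Et tJ]; exact: EJ.
Qed.

Lemma part_modular E F J : lebesgue_measurable E -> lebesgue_measurable F ->
  nondegenerate_itv J ->
  part (E `|` F) J = part E J + part F J - part (E `&` F) J.
Proof.
move=> mE mF nJ.
have mJ := lebesgue_measurable_itv J.
have mEJ := lebesgue_measurableI mE mJ; have mFJ := lebesgue_measurableI mF mJ.
have : leb ((E `|` F) `&` [set` J]) = (leb (E `&` [set` J]) +
    leb (F `&` [set` J]) - leb ((E `&` F) `&` [set` J]))%E.
  have -> : (E `&` F) `&` [set` J] = (E `&` [set` J]) `&` (F `&` [set` J]).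
    by rewrite setIACA setIid.
  rewrite setIUl; apply: measureUfinl; [exact: mEJ|exact: mFJ|].
  by apply: le_lt_trans (part_bound mE nJ) _; rewrite ltry.
rewrite !partE//; last 2 first.
- exact: lebesgue_measurableI.
- exact: lebesgue_measurableU.
by move=> [].
Qed.

Lemma part_subadditive E F V J : lebesgue_measurable E ->
  lebesgue_measurable F -> lebesgue_measurable V -> nondegenerate_itv J ->
  E `<=` F `|` V -> part E J <= part F J + part V J.
Proof.
move=> mE mF mV nJ EFV; have mJ := lebesgue_measurable_itv J.
rewrite -lee_fin EFinD -!partE//.
have mEJ := lebesgue_measurableI mE mJ; have mFJ := lebesgue_measurableI mF mJ.
have mVJ := lebesgue_measurableI mV mJ.
apply: le_trans (leb_setU_le mFJ mVJ).
apply: leb_le => //; first exact: lebesgue_measurableU.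
by rewrite -setIUl; apply: setSI.
Qed.

Lemma part_dist E F V J : lebesgue_measurable E ->
  lebesgue_measurable F -> lebesgue_measurable V -> nondegenerate_itv J ->
  (forall t, ~ V t -> E t <-> F t) -> `|part E J - part F J| <= part V J.
Proof.
move=> mE mF mV nJ EFV.
have h1 : part E J <= part F J + part V J.
  apply: part_subadditive => // t Et; have [Vt|Vt] := pselect (V t); [by right|].
  by left; apply/EFV.
have h2 : part F J <= part E J + part V J.
  apply: part_subadditive => // t Et; have [Vt|Vt] := pselect (V t); [by right|].
  by left; apply/EFV.
by rewrite ler_norml; apply/andP; split; lra.
Qed.

(** The two end-points have measure zero. *)
Lemma leb_interior V J : lebesgue_measurable V -> nondegenerate_itv J ->
  (leb (V `&` [set` J]) <= leb (V `&` [set` `]lo J, hi J[]))%E.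
Proof.
move=> mV nJ.
have mJ K : lebesgue_measurable [set` K] by exact: lebesgue_measurable_itv.
have m1 (t : R) : lebesgue_measurable [set t] by rewrite -set_itv1; exact: mJ.
have mVJ K := lebesgue_measurableI mV (mJ K).
have mlh : lebesgue_measurable ([set lo J] `|` [set hi J]).
  exact: lebesgue_measurableU.
have -> : leb (V `&` [set` `]lo J, hi J[]) =
    (leb (V `&` [set` `]lo J, hi J[]) + (leb [set lo J] + leb [set hi J]))%E.
  by rewrite !leb_set1 !adde0.
have mVU := lebesgue_measurableU (mVJ `]lo J, hi J[) mlh.
apply: (@le_trans _ _ (leb ((V `&` [set` `]lo J, hi J[]) `|`
    ([set lo J] `|` [set hi J])))%E).
  apply: leb_le => // t /= [Vt tJ].
  have /andP[l h] := nondegenerate_mem_ge nJ tJ; rewrite in_itv/=.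
  have [->|tl] := eqVneq t (lo J); first by right; left.
  have [->|th] := eqVneq t (hi J); first by right; right.
  by left; split=> //; rewrite !lt_neqAle l h eq_sym tl th.
apply: le_trans (leb_setU_le (mVJ _) mlh) _.
by rewrite leeD2l// leb_setU_le.
Qed.

Lemma trivIset_interiors V D : separated_family D ->
  trivIset [set` D] (fun J => V `&` [set` `]lo J, hi J[]).
Proof.
move=> sD J K JD KD [t [[_ /=]]]; rewrite in_itv/= => /andP[h1 h2] [_ /=].
rewrite in_itv/= => /andP[h3 h4]; apply: contrapT => /eqP JK.
have /orP[JK'|KJ'] := sD J K JD KD JK.
  by move: (lt_trans (lt_le_trans h2 JK') h3); rewrite ltxx.
by move: (lt_trans (lt_le_trans h4 KJ') h1); rewrite ltxx.
Qed.

Definition interiors D : set R := \bigcup_(J in [set` D]) [set` `]lo J, hi J[].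

Lemma lebesgue_measurable_interiors D : lebesgue_measurable (interiors D).
Proof.
apply: fin_bigcup_measurable => // J _; exact: lebesgue_measurable_itv.
Qed.

Lemma leb_interiors V D : lebesgue_measurable V -> separated_family D ->
  leb (V `&` interiors D) = (\sum_(J <- D) leb (V `&` [set` `]lo J, hi J[]))%E.
Proof.
move=> mV sD; rewrite -(@measure_fbigsetU _ _ _ leb); last 2 first.
- move=> J JD; apply: lebesgue_measurableI => //.
  exact: lebesgue_measurable_itv.
- exact: trivIset_interiors.
by rewrite -bigcup_fset /interiors setI_bigcupr.
Qed.

Lemma leb_interiorsT D : (forall J, J \in D -> nondegenerate_itv J) ->
  separated_family D ->
  leb (interiors D) = (\sum_(J <- D) itv_length J)%:E.
Proof.
move=> nD sD; rewrite -(setTI (interiors D)) leb_interiors//; last first.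
  exact: measurableT.
rewrite -sumEFin big_seq [RHS]big_seq; apply: eq_bigr => J JD.
rewrite setTI leb_itv//=; last exact: nondegenerate_lo_hi (nD _ JD).
by rewrite itv_lengthE// nD.
Qed.

(** Non-overlapping intervals may share end-points, but their interiors are
disjoint, so additivity applies to these. *)
Lemma sum_part_le V D r : lebesgue_measurable V ->
  (forall J, J \in D -> nondegenerate_itv J) -> separated_family D ->
  (leb V <= r%:E)%E -> \sum_(J <- D) part V J <= r.
Proof.
move=> mV nD sD Vr; rewrite -lee_fin.
have -> : (\sum_(J <- D) part V J)%:E =
    (\sum_(J <- D) leb (V `&` [set` J]))%E.
  rewrite -sumEFin big_seq [RHS]big_seq; apply: eq_bigr => J JD.
  by rewrite partE// nD.
apply: (@le_trans _ _ (\sum_(J <- D) leb (V `&` [set` `]lo J, hi J[]))%E).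
  rewrite big_seq [leRHS]big_seq; apply: lee_sum => J JD.
  by apply: leb_interior => //; exact: nD.
rewrite -leb_interiors//; apply: le_trans Vr; apply: leb_le => //.
apply: lebesgue_measurableI => //; exact: lebesgue_measurable_interiors.
Qed.

Lemma sum_length_le a b D : a < b ->
  (forall J, J \in D -> interval_in a b J) -> separated_family D ->
  \sum_(J <- D) itv_length J <= b - a.
Proof.
move=> ab DW sD.
have nD J : J \in D -> nondegenerate_itv J by move=> /DW/interval_inE[].
have mW := lebesgue_measurable_itv `[a, b].
have -> : \sum_(J <- D) itv_length J = \sum_(J <- D) part [set` `[a, b]] J.
  rewrite big_seq [RHS]big_seq; apply: eq_bigr => J JD.
  rewrite part_full ?nD// => t /andP[h1 h2] /=; rewrite in_itv/=.
  by have /interval_inE[_ h3 h4] := DW _ JD; apply/andP; split; lra.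
by apply: sum_part_le => //; rewrite leb_itv.
Qed.

End LebesgueParts.

(** * Density sums *)

Section DensitySums.
Variable R : realType.
Implicit Types (I J K : interval R) (D P Q : {fset interval R}).
Implicit Types (a b e r : R) (E F V : set R) (g : interval R -> R).

Local Notation leb := (@completed_lebesgue_measure R).

Definition density_sum g D E : R := \sum_(J <- D) density_fun g E J.

Lemma density_funE g E J : density_fun g E J = g J * part E J / itv_length J.
Proof. by []. Qed.

Lemma density_full g E J : lebesgue_measurable E -> nondegenerate_itv J ->
  (forall t, lo J < t < hi J -> E t) -> density_fun g E J = g J.
Proof.
move=> mE nJ EJ; rewrite density_funE part_full// mulfK//.
by rewrite gt_eqF// itv_length_gt0.
Qed.

Lemma density_null g E J p : lebesgue_measurable E -> nondegenerate_itv J ->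
  (forall t, E t -> t \in J -> t = p) -> density_fun g E J = 0.
Proof.
by move=> mE nJ EJ; rewrite density_funE (part_null mE nJ EJ) mulr0 mul0r.
Qed.

Lemma density_sum_modular g D E F : lebesgue_measurable E ->
  lebesgue_measurable F -> (forall J, J \in D -> nondegenerate_itv J) ->
  density_sum g D (E `|` F) =
  density_sum g D E + density_sum g D F - density_sum g D (E `&` F).
Proof.
move=> mE mF nD; rewrite /density_sum -big_split -sumrB /= big_seq [RHS]big_seq.
apply: eq_bigr => J JD; rewrite !density_funE part_modular ?nD//.
by rewrite mulrBr mulrDr mulrBl mulrDl.
Qed.

Lemma density_sum_dist g D E F V : lebesgue_measurable E ->
  lebesgue_measurable F -> lebesgue_measurable V ->
  (forall J, J \in D -> nondegenerate_itv J) ->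
  (forall t, ~ V t -> E t <-> F t) ->
  `|density_sum g D E - density_sum g D F| <=
  \sum_(J <- D) `|g J| * (part V J / itv_length J).
Proof.
move=> mE mF mV nD EFV; rewrite /density_sum -sumrB.
apply: le_trans (ler_norm_sum _ _ _) _.
rewrite big_seq [leRHS]big_seq; apply: ler_sum => J JD.
have lJ := itv_length_gt0 (nD _ JD).
rewrite !density_funE -mulrBl -mulrBr !normrM mulrA normfV (gtr0_norm lJ).
rewrite ler_wpM2r ?invr_ge0 ?(ltW lJ)// ler_wpM2l//.
by apply: part_dist => //; exact: nD.
Qed.

(** The density of the signed measure [density_sum g D] with respect to Lebesgue
measure is the step function with value [g J / itv_length J] on [J]; this
bounds it. *)
Definition density_bound g D : R := \sum_(J <- D) `|g J| / itv_length J.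

Lemma density_bound_ge0 g D : (forall J, J \in D -> nondegenerate_itv J) ->
  0 <= density_bound g D.
Proof.
move=> nD; rewrite /density_bound big_seq sumr_ge0// => J JD.
by rewrite divr_ge0// ltW// itv_length_gt0// nD.
Qed.

Lemma density_sum_dist_bound g D E F V r : lebesgue_measurable E ->
  lebesgue_measurable F -> lebesgue_measurable V ->
  (forall J, J \in D -> nondegenerate_itv J) ->
  (forall t, ~ V t -> E t <-> F t) -> (leb V <= r%:E)%E ->
  `|density_sum g D E - density_sum g D F| <= density_bound g D * r.
Proof.
move=> mE mF mV nD EFV Vr; apply: le_trans (density_sum_dist g mE mF mV nD EFV) _.
rewrite /density_bound mulr_suml big_seq [leRHS]big_seq.
apply: ler_sum => J JD; have lJ := itv_length_gt0 (nD _ JD).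
rewrite [part V J / _]mulrC mulrA ler_wpM2l//.
  by rewrite mulr_ge0// invr_ge0 ltW.
by apply: part_le_leb => //; exact: nD.
Qed.

Lemma sum_dist_le P (f h : interval R -> R) e : 0 <= e ->
  (forall I, I \in P -> `|f I - h I| <= e / (size P).+1%:R) ->
  `|\sum_(I <- P) f I - \sum_(I <- P) h I| <= e.
Proof.
move=> e0 fh; rewrite -sumrB; apply: le_trans (ler_norm_sum _ _ _) _.
apply: (@le_trans _ _ (\sum_(I <- P) e / (size P).+1%:R)).
  by rewrite big_seq [leRHS]big_seq; apply: ler_sum.
rewrite big_const_seq count_predT iter_addr_0 -[_ *+ size P]mulr_natr.
rewrite -mulrA ler_piMr// mulrC ler_pdivrMr ?ltr0Sn// mul1r.
by rewrite ler_nat.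
Qed.

(** Each member [I] of a finite family is replaced by a fine division of [I]
whose sum is so close to the norm-limit over [I] that the errors add up to at
most [eps]. *)
Lemma fine_replacement g P eps delta : 0 < eps -> 0 < delta ->
  (forall I, I \in P -> nondegenerate_itv I /\ norm_limit_exists g I) ->
  exists F : interval R -> {fset interval R},
    (forall I, I \in P -> subdivides (lo I) (hi I) (F I) /\
                          fine_family delta (F I)) /\
    `|\sum_(I <- P) \sum_(J <- F I) g J - \sum_(I <- P) norm_limit g I| <= eps.
Proof.
move=> eps0 delta0 HP; pose c := eps / (size P).+1%:R.
have c0 : 0 < c by rewrite divr_gt0.
have /choice[F FP] : forall I, exists D, I \in P ->
    [/\ subdivides (lo I) (hi I) D, fine_family delta D
      & `|\sum_(J <- D) g J - norm_limit g I| <= c].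
  move=> I; have [IP|] := boolP (I \in P); last by exists fset0.
  have [nI lim] := HP _ IP.
  have [eta eta0 H] := norm_limit_sums_tend_to nI lim c0.
  have m0 : 0 < Num.min eta delta by rewrite lt_min eta0.
  have [D [fD sD]] := exists_fine_subdivision (nondegenerate_lo_hi nI) m0.
  exists D => _; split=> //.
    by apply: fine_familyW fD; rewrite ge_min lexx orbT.
  by apply: H => //; apply: fine_familyW fD; rewrite ge_min lexx.
exists F; split; first by move=> I /FP[].
by apply: sum_dist_le; [exact: ltW|move=> I /FP[]].
Qed.

End DensitySums.

(** * Necessity: the norm-limit and concentrated density *)

Section Necessity.
Variables (R : realType) (A B : R).
Hypothesis ltAB : A < B.
Variable g : interval R -> R.
Hypothesis density_Cauchy : forall E : set R, E `<=` `[A, B] ->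
  lebesgue_measurable E -> Cauchy_sums (density_fun g E) A B.
Implicit Types (I J : interval R) (D P Q : {fset interval R}).
Implicit Types (e r delta : R) (E U V : set R).

Local Notation leb := (@completed_lebesgue_measure R).
Local Notation S := (density_sum g).

Lemma necessary_norm_limit I : interval_in A B I -> norm_limit_exists g I.
Proof.
move=> IW; have /interval_inE[nI _ _] := IW.
apply: Cauchy_sums_norm_limit => //; apply: (Cauchy_sums_sub IW) => eps eps0.
have mW : lebesgue_measurable [set` `[A, B]] by exact: lebesgue_measurable_itv.
have [eta eta0 H] := density_Cauchy (@subset_refl _ _) mW eps0.
exists eta => // D D' sD fD sD' fD'; have := H D D' sD fD sD' fD'.
have SE P : subdivides A B P ->
    \sum_(J <- P) density_fun g `[A, B] J = \sum_(J <- P) g J.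
  move=> sP; rewrite big_seq [RHS]big_seq; apply: eq_bigr => J JP.
  apply: density_full => //; first exact: subdivides_nondegenerate sP _ JP.
  move=> t /andP[h1 h2] /=; rewrite in_itv/=.
  by rewrite (le_trans (subdivides_lo sP JP) (ltW h1))
    (le_trans (ltW h2) (subdivides_hi sP JP)).
by rewrite !SE.
Qed.

(** If the norm-limit is not absolutely continuous, some sets of arbitrarily
small measure carry, in arbitrarily fine divisions, a fixed amount of the
density sum: fill a bad family by fine divisions, and take the union of its
interiors. *)
Lemma concentrated_density eps delta : 0 < eps -> 0 < delta ->
  (exists P, [/\ forall I, I \in P -> interval_in A B I, separated_family P,
    \sum_(I <- P) itv_length I < delta &
    eps <= `|\sum_(I <- P) norm_limit g I| ]) ->
  exists DU : {fset interval R} * set R,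
    [/\ subdivides A B DU.1, fine_family delta DU.1, lebesgue_measurable DU.2,
        DU.2 `<=` `[A, B] & (leb DU.2 <= delta%:E)%E /\
        eps / 2 <= `|S DU.1 DU.2| ].
Proof.
move=> eps0 delta0 [P [PW sP lP epsP]].
have nP I : I \in P -> nondegenerate_itv I by move=> /PW/interval_inE[].
have e20 : 0 < eps / 2 by rewrite divr_gt0.
have [|F [FP sumF]] := @fine_replacement _ g P _ _ e20 delta0.
  by move=> I IP; split; [exact: nP|apply: necessary_norm_limit; exact: PW].
have [Q [fQ dPQ sPQ]] := extend_to_subdivision ltAB delta0 PW sP.
have [|sDQ dDQ sumD] := subdivides_refine (F := F) sPQ dPQ.
  by move=> I /FP[].
set D := (\bigcup_(I <- P) F I)%fset in sDQ dDQ sumD.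
have mU := lebesgue_measurable_interiors P.
exists ((D `|` Q)%fset, interiors P); split=> //=.
- apply: fine_familyU => //; apply: fine_family_bigcup => I IP.
  by have [] := FP _ IP.
- move=> t [I /= IP]; have /interval_inE[_ h1 h2] := PW _ IP.
  by rewrite !in_itv/= => /andP[h3 h4]; apply/andP; split; lra.
split; first by rewrite leb_interiorsT// lee_fin ltW.
have nDQ J : J \in (D `|` Q)%fset -> nondegenerate_itv J.
  exact: subdivides_nondegenerate sDQ J.
have -> : S (D `|` Q)%fset (interiors P) =
    \sum_(I <- P) \sum_(J <- F I) g J.
  rewrite /density_sum big_fsetU_disjoint// -sumD [X in _ + X]big1_seq ?addr0.
    rewrite big_seq [RHS]big_seq; apply: eq_bigr => J JD.
    have /bigfcupP[I /andP[IP _] JF] := JD; have [sF _] := FP _ IP.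
    apply: density_full => //; first by apply: nDQ; rewrite in_fsetU JD.
    move=> t /andP[h1 h2]; exists I => //=; rewrite in_itv/=.
    by rewrite (le_lt_trans (subdivides_lo sF JF) h1)
      (lt_le_trans h2 (subdivides_hi sF JF)).
  move=> J /andP[_ JQ]; have nJ : nondegenerate_itv J.
    by apply: nDQ; rewrite in_fsetU JQ orbT.
  apply: (@density_null _ _ _ _ 0) => // t [I /= IP].
  rewrite in_itv/= => /andP[h1 h2] /(nondegenerate_mem_ge nJ)/andP[h3 h4].
  have IJ : I != J.
    by apply: contraTneq JQ => <-; move/fdisjointP : dPQ; apply.
  have : separated I J.
    by apply: (subdivides_separated sPQ) => //; rewrite in_fsetU ?IP ?JQ ?orbT.
  by case/orP => ?; exfalso; lra.
move: sumF; set x := \sum_(I <- P) _; set y := \sum_(I <- P) _ => xy.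
have := ler_normB x (x - y); rewrite opprB addrC subrK => h.
by have := le_trans epsP h; lra.
Qed.

End Necessity.

(** * Necessity: the gliding hump *)

Section GlidingHump.
Variables (R : realType) (A B : R) (g : interval R -> R) (eps : R).
Hypothesis eps0 : 0 < eps.
Implicit Types (D : {fset interval R}) (E U V : set R).

Local Notation leb := (@completed_lebesgue_measure R).
Local Notation S := (density_sum g).

Variable hump : R -> {fset interval R} * set R.
Hypothesis humpP : forall delta : R, 0 < delta ->
  [/\ subdivides A B (hump delta).1, fine_family delta (hump delta).1,
      lebesgue_measurable (hump delta).2, (hump delta).2 `<=` `[A, B]
    & (leb (hump delta).2 <= delta%:E)%E /\
      eps <= `|S (hump delta).1 (hump delta).2| ].

(** The state is the current division, the current set and a bound on the total
measure of all later modifications of the set. Adding or removing the next hump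
gives two sets whose density sums differ by at least [eps], so one of them is
at distance at least [eps / 2] from the previous density sum. The second term of
the budget makes the later modifications change the density sum over the
current division by at most [eps / 8]; the first makes them summable, and makes
the norms of the divisions tend to 0. *)
Definition hump_step (s : {fset interval R} * set R * R) :=
  let: (D, E, r) := s in
  let: (D', U) := hump (r / 2) in
  (D', if eps / 2 <= `|S D' (E `|` U) - S D E| then E `|` U else E `\` U,
   Num.min (r / 2) (eps / 8 / (density_bound g D' + 1))).

Definition hump_state k := iter k hump_step (fset0, set0, 1).
Definition hump_division k := (hump_state k).1.1.
Definition hump_set k := (hump_state k).1.2.
Definition hump_budget k := (hump_state k).2.
Definition hump_change k := (hump (hump_budget k / 2)).2.

Lemma hump_divisionS k : hump_division k.+1 = (hump (hump_budget k / 2)).1.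
Proof.
rewrite /hump_division /hump_budget /hump_state iterS /hump_step.
by case: (iter _ _ _) => [[D E] r] /=; case: (hump _).
Qed.

Lemma hump_setS k : hump_set k.+1 =
  if eps / 2 <= `|S (hump_division k.+1) (hump_set k `|` hump_change k) -
                  S (hump_division k) (hump_set k)|
  then hump_set k `|` hump_change k else hump_set k `\` hump_change k.
Proof.
rewrite hump_divisionS /hump_set /hump_change /hump_budget /hump_division.
rewrite /hump_state iterS [hump_step (iter _ _ _)]/hump_step.
by case: (iter _ _ _) => [[D E] r] /=; case: (hump _).
Qed.

Lemma hump_budgetS k : hump_budget k.+1 = Num.min (hump_budget k / 2)
  (eps / 8 / (density_bound g (hump_division k.+1) + 1)).
Proof.
rewrite hump_divisionS /hump_budget /hump_state iterS.
rewrite [hump_step (iter _ _ _)]/hump_step.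
by case: (iter _ _ _) => [[D E] r] /=; case: (hump _).
Qed.

Lemma hump_invariant k : [/\ 0 < hump_budget k,
  forall J, J \in hump_division k -> nondegenerate_itv J,
  lebesgue_measurable (hump_set k) & hump_set k `<=` `[A, B]].
Proof.
elim: k => [|k [r0 nD mE EW]].
  by split=> //; exact: lebesgue_measurable0.
have r2 : 0 < hump_budget k / 2 by rewrite divr_gt0.
have [sD _ mU UW _] := humpP r2.
have nD' J : J \in hump_division k.+1 -> nondegenerate_itv J.
  by rewrite hump_divisionS; exact: subdivides_nondegenerate sD _.
split=> //.
- rewrite hump_budgetS lt_min r2/= !divr_gt0// ltr_wpDl//.
  exact: density_bound_ge0.
- rewrite hump_setS; case: ifP => _.
    exact: lebesgue_measurableU.
  exact: lebesgue_measurableD.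
- rewrite hump_setS; case: ifP => _; first by rewrite subUset.
  exact: subset_trans (@subDsetl _ _ _) EW.
Qed.

Lemma hump_budget_half k : hump_budget k.+1 <= hump_budget k / 2.
Proof. by rewrite hump_budgetS ge_min lexx. Qed.

Lemma hump_budget_geometric k j :
  hump_budget (k + j) <= hump_budget k / (2 ^ j)%:R.
Proof.
elim: j => [|j IH]; first by rewrite addn0 expn0 divr1.
rewrite addnS; apply: le_trans (hump_budget_half _) _.
by rewrite expnSr natrM invfM mulrA ler_pM2r// invr_gt0.
Qed.

Lemma hump_budget_small e : 0 < e -> exists k, hump_budget k < e.
Proof.
move=> e0; exists (Num.bound e^-1); set k := Num.bound _.
have ek : e^-1 < k%:R by apply: archi_boundP; rewrite invr_ge0 ltW.
have := hump_budget_geometric 0 k; rewrite add0n => /le_lt_trans; apply.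
have -> : hump_budget 0 = 1 by [].
rewrite mul1r -[ltRHS]invrK ltf_pV2 ?posrE ?invr_gt0// ?ltr0n ?expn_gt0//.
by apply: lt_trans ek _; rewrite ltr_nat ltn_expl.
Qed.

(** The density sums of the two candidates for the next set differ by the density
sum of the hump. *)
Lemma hump_distance k : eps / 2 <=
  `|S (hump_division k.+1) (hump_set k.+1) - S (hump_division k) (hump_set k)|.
Proof.
have [r0 _ mE _] := hump_invariant k.
have r2 : 0 < hump_budget k / 2 by rewrite divr_gt0.
have [sD _ mU _ [_ epsU]] := humpP r2.
rewrite hump_setS; case: ifP => // /negbT; rewrite -ltNge.
rewrite hump_divisionS -/(hump_change k) in epsU *.
set D := (hump _).1 in epsU sD *; set U := hump_change k in epsU mU *.
set E := hump_set k in mE *; set x := S (hump_division k) E.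
have : S D (E `|` U) = S D (E `\` U) + S D U.
  have -> : E `|` U = (E `\` U) `|` U by rewrite setUDl setDv setD0.
  rewrite density_sum_modular//; last 2 first.
  - exact: lebesgue_measurableD.
  - exact: subdivides_nondegenerate sD.
  rewrite setDKI [X in _ - X]/density_sum [X in _ - X]big1_seq ?subr0//.
  move=> J /andP[_ JD]; apply: (@density_null _ _ _ _ 0) => //.
    exact: lebesgue_measurable0.
  exact: subdivides_nondegenerate sD _ JD.
move: epsU; rewrite !ler_normr ltr_norml => /orP[?|?] -> /andP[? ?].
  by apply/orP; right; lra.
by apply/orP; left; lra.
Qed.

Definition hump_tail k := \bigcup_j hump_change (k + j).

Lemma lebesgue_measurable_hump_change k :
  lebesgue_measurable (hump_change k).
Proof.
have [r0 _ _ _] := hump_invariant k.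
by have [] := humpP (divr_gt0 r0 (ltr0n R 2)).
Qed.

Lemma lebesgue_measurable_hump_tail k : lebesgue_measurable (hump_tail k).
Proof.
apply: lebesgue_measurable_bigcup => j.
exact: lebesgue_measurable_hump_change.
Qed.

Lemma leb_hump_tail k : (leb (hump_tail k) <= (hump_budget k)%:E)%E.
Proof.
have [r0 _ _ _] := hump_invariant k.
apply: le_trans (epsilon_trick0 xpredT (ltW r0)).
apply: le_trans (measure_sigma_subadditive leb _ _ (@subset_refl _ _)) _.
- by move=> j; exact: lebesgue_measurable_hump_change.
- exact: lebesgue_measurable_hump_tail.
apply: lee_nneseries => // j _.
have [rj _ _ _] := hump_invariant (k + j).
have r2 : 0 < hump_budget (k + j) / 2 by rewrite divr_gt0.
have [_ _ _ _ [le _]] := humpP r2; apply: le_trans le _.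
rewrite lee_fin expnSr natrM invfM mulrA ler_pM2r ?invr_gt0//.
exact: hump_budget_geometric.
Qed.

(** The lower limit of the sets; it agrees with [hump_set k] outside
[hump_tail k]. *)
Definition hump_limit : set R := \bigcup_k \bigcap_j hump_set (k + j).

Lemma lebesgue_measurable_hump_limit : lebesgue_measurable hump_limit.
Proof.
apply: lebesgue_measurable_bigcup => k; apply: lebesgue_measurable_bigcap => j.
by have [] := hump_invariant (k + j).
Qed.

Lemma hump_limit_sub : hump_limit `<=` `[A, B].
Proof.
move=> t [k _ /(_ 0%N I)]; have [_ _ _ EW] := hump_invariant (k + 0).
exact: EW.
Qed.

Lemma hump_limit_tail k t :
  ~ hump_tail k t -> hump_limit t <-> hump_set k t.
Proof.
move=> nt; have stable j : hump_set (k + j) t <-> hump_set k t.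
  elim: j => [|j IH]; first by rewrite addn0.
  have nU : ~ hump_change (k + j) t by move=> Ut; apply: nt; exists j.
  rewrite addnS -IH hump_setS; case: ifP => _; split=> //.
  - by case.
  - by left.
  - by case.
split; last by move=> Et; exists k => // j _; apply/stable.
move=> [i _ Ei]; apply/(stable i); rewrite addnC; exact: Ei.
Qed.

Lemma hump_limit_close k :
  `|S (hump_division k.+1) hump_limit - S (hump_division k.+1) (hump_set k.+1)|
  <= eps / 8.
Proof.
have [r0 nD mE _] := hump_invariant k.+1.
have := density_sum_dist_bound g lebesgue_measurable_hump_limit mE
  (lebesgue_measurable_hump_tail k.+1) nD (@hump_limit_tail k.+1)
  (leb_hump_tail k.+1).
move=> /le_trans; apply.
have c0 := density_bound_ge0 g nD.
have c1 : 0 < density_bound g (hump_division k.+1) + 1 by rewrite ltr_wpDl.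
apply: (@le_trans _ _ ((density_bound g (hump_division k.+1) + 1) *
    hump_budget k.+1)).
  by rewrite ler_pM2r// lerDl.
by rewrite mulrC -ler_pdivlMr// hump_budgetS ge_min lexx orbT.
Qed.

(** Consecutive density sums of the limit set differ by at least
eps / 2 - eps / 8 - eps / 8, although the divisions become arbitrarily fine. *)
Lemma hump_limit_not_Cauchy : ~ Cauchy_sums (density_fun g hump_limit) A B.
Proof.
move=> /(_ (eps / 8)) []; first by rewrite divr_gt0.
move=> eta eta0 H; have [k rk] := hump_budget_small eta0.
have good j : subdivides A B (hump_division j.+1) /\
    fine_family (hump_budget j) (hump_division j.+1).
  have [r0 _ _ _] := hump_invariant j.
  have r2 : 0 < hump_budget j / 2 by rewrite divr_gt0.
  have [sD fD _ _ _] := humpP r2; rewrite hump_divisionS; split=> //.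
  by apply: fine_familyW fD; rewrite ler_pdivrMr// ler_peMr ?ler1n// ltW.
have [sD fD] := good k; have [sD' fD'] := good k.+1.
have r0 : 0 < hump_budget k by have [] := hump_invariant k.
have rk' : hump_budget k.+1 <= hump_budget k.
  apply: le_trans (hump_budget_half k) _.
  by rewrite ler_pdivrMr// ler_peMr ?ler1n// ltW.
have := H _ _ sD (fine_familyW (ltW rk) fD) sD'
  (fine_familyW (le_trans rk' (ltW rk)) fD').
have := hump_limit_close k; have := hump_limit_close k.+1.
have := hump_distance k.+1; rewrite -![\sum_(J <- _) _]/(density_sum _ _ _).
move: (S (hump_division k.+2) hump_limit) => x.
move: (S (hump_division k.+1) hump_limit) => y.
move: (S _ (hump_set k.+2)) (S _ (hump_set k.+1)) => u v; clear -eps0.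
rewrite ler_normr !ler_norml => h1 /andP[h2 h3] /andP[h4 h5] /andP[h6 h7].
suff : eps <= 0 by rewrite leNgt eps0.
by case/orP: h1 => h1; lra.
Qed.

End GlidingHump.

Section NecessaryAC.
Variables (R : realType) (A B : R) (g : interval R -> R).
Hypothesis ltAB : A < B.

Lemma necessary_absolute_continuity :
  (forall E : set R, E `<=` `[A, B] -> lebesgue_measurable E ->
    Cauchy_sums (density_fun g E) A B) ->
  ac_interval_function A B (norm_limit g).
Proof.
move=> density_Cauchy eps eps0; apply: contrapT => noac.
have bad (delta : R) : exists DU : {fset interval R} * set R, 0 < delta ->
    [/\ subdivides A B DU.1, fine_family delta DU.1, lebesgue_measurable DU.2,
        DU.2 `<=` `[A, B] &
        (completed_lebesgue_measure DU.2 <= delta%:E)%E /\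
        eps / 2 <= `|density_sum g DU.1 DU.2| ].
  have [delta0|] := ltP 0 delta; last by exists (fset0, set0).
  have [|DU HDU] := concentrated_density ltAB density_Cauchy eps0 delta0.
    apply: contrapT => noP; apply: noac; exists delta => // P PW sP lP.
    rewrite ltNge; apply/negP => epsP; apply: noP; exists P; split=> //.
    by apply/non_overlappingP => // J /PW/interval_inE[].
  by exists DU.
have /choice[hump humpP] := bad.
have e20 : 0 < eps / 2 by rewrite divr_gt0.
apply: (hump_limit_not_Cauchy e20 humpP); apply: density_Cauchy.
- exact: (@hump_limit_sub _ _ _ _ _ e20 _ humpP).
- exact: (@lebesgue_measurable_hump_limit _ _ _ _ _ e20 _ humpP).
Qed.

End NecessaryAC.

(** * Sufficiency: absolute continuity on fine families *)

Section WeightedSums.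
Variables (R : realType) (g w : interval R -> R) (eps delta : R).
Implicit Types D P Q : {fset interval R}.
Hypothesis delta0 : 0 < delta.

Lemma sum_fsetD (f : interval R -> R) P Q : (Q `<=` P)%fset ->
  \sum_(J <- P) f J = \sum_(J <- Q) f J + \sum_(J <- (P `\` Q)%fset) f J.
Proof.
move=> QP; rewrite -{1}(fsetID Q P) big_fsetU_disjoint; last first.
  by apply/fdisjointP => J; rewrite !inE => /andP[_ ->].
by move/fsetIidPr : QP => ->.
Qed.

Variable D : {fset interval R}.
Hypothesis w_ge0 : forall J, J \in D -> 0 <= w J.
Hypothesis w_small : forall J, J \in D -> w J < delta / 2.
Hypothesis g_light : forall P, (P `<=` D)%fset ->
  \sum_(J <- P) w J < delta -> `|\sum_(J <- P) g J| <= eps.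

Lemma sum_light_ge0 P : (P `<=` D)%fset -> 0 <= \sum_(J <- P) w J.
Proof.
by move=> /fsubsetP PD; rewrite big_seq sumr_ge0// => J /PD/w_ge0.
Qed.

Lemma sum_sub_le P Q (f : interval R -> R) : (Q `<=` P)%fset ->
  (forall J, J \in P -> 0 <= f J) ->
  \sum_(J <- Q) f J <= \sum_(J <- P) f J.
Proof.
move=> QP f0; rewrite (sum_fsetD f QP) lerDl big_seq sumr_ge0// => J.
by rewrite in_fsetD => /andP[_ /f0].
Qed.

(** Apply the bound to the members with nonnegative and with negative value
separately. *)
Lemma sum_norm_light P : (P `<=` D)%fset -> \sum_(J <- P) w J < delta ->
  \sum_(J <- P) `|g J| <= eps *+ 2.
Proof.
move=> PD wP; rewrite (big_fsetID _ (fun J => 0 <= g J)) /=.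
set P1 := [fset _ in _ | _]%fset; set P2 := [fset _ in _ | _]%fset.
have P1P : (P1 `<=` P)%fset by exact: fset_sub.
have P2P : (P2 `<=` P)%fset by exact: fset_sub.
have wP0 J : J \in P -> 0 <= w J by move=> /(fsubsetP PD)/w_ge0.
have h1 := g_light (fsubset_trans P1P PD) (le_lt_trans (sum_sub_le P1P wP0) wP).
have h2 := g_light (fsubset_trans P2P PD) (le_lt_trans (sum_sub_le P2P wP0) wP).
have -> : \sum_(J <- P1) `|g J| = \sum_(J <- P1) g J.
  rewrite big_seq [RHS]big_seq; apply: eq_bigr => J.
  by rewrite !inE /= => /andP[_ gJ]; rewrite ger0_norm.
have -> : \sum_(J <- P2) `|g J| = - \sum_(J <- P2) g J.
  rewrite -sumrN big_seq [RHS]big_seq; apply: eq_bigr => J.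
  by rewrite !inE /= -ltNge => /andP[_ gJ]; rewrite ltr0_norm.
rewrite mulr2n lerD//; first exact: le_trans (ler_norm _) h1.
by apply: le_trans (ler_norm _) _; rewrite normrN.
Qed.

(** Removing members one at a time decreases the total weight by steps shorter
than the window [delta / 2, delta). *)
Lemma exists_medium_subfamily P : (P `<=` D)%fset ->
  delta / 2 <= \sum_(J <- P) w J -> exists Q, [/\ (Q `<=` P)%fset,
    delta / 2 <= \sum_(J <- Q) w J & \sum_(J <- Q) w J < delta].
Proof.
have [n] := ubnP #|` P|%fset; elim: n P => // n IH P cP PD wP.
have [wPd|dwP] := ltP (\sum_(J <- P) w J) delta; first by exists P.
have [P0|[J JP]] := fset_0Vmem P.
  by move: dwP; rewrite P0 big_seq_fset0 leNgt delta0.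
have [|||Q [QP Q1 Q2]] := IH (P `\ J)%fset.
- by move: cP; rewrite (cardfsD1 J) JP.
- exact: fsubset_trans (fsubsetDl _ _) PD.
- rewrite (big_fsetD1 J)//= in dwP.
  by have := w_small (fsubsetP PD _ JP); lra.
by exists Q; split=> //; exact: fsubset_trans QP (fsubsetDl _ _).
Qed.

(** Cut off subfamilies of weight between [delta / 2] and [delta]; each of
them contributes at most [eps *+ 2] and uses up at least [delta / 2] of the
weight. *)
Lemma sum_norm_bounded P : (P `<=` D)%fset ->
  \sum_(J <- P) `|g J| <=
  eps *+ 2 * (1 + 2 / delta * \sum_(J <- P) w J).
Proof.
have eps_ge0 : 0 <= eps.
  have := g_light (fsub0set D); rewrite !big_seq_fset0 normr0; exact.
have [n] := ubnP #|` P|%fset; elim: n P => // n IH P cP PD.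
have wP0 := sum_light_ge0 PD.
have [wPd|dwP] := ltP (\sum_(J <- P) w J) delta.
  apply: le_trans (sum_norm_light PD wPd) _.
  rewrite ler_peMr ?mulrn_wge0// lerDl mulr_ge0//.
  by rewrite divr_ge0// ltW.
have [|Q [QP Q1 Q2]] := exists_medium_subfamily PD.
  by apply: le_trans dwP; rewrite ler_pdivrMr// ler_peMr ?ler1n// ltW.
have QD := fsubset_trans QP PD.
have PQD := fsubset_trans (fsubsetDl P Q) PD.
rewrite (sum_fsetD (fun J => `|g J|) QP) (sum_fsetD w QP).
rewrite [2 / delta * _]mulrDr addrCA mulrDr; apply: lerD.
  apply: le_trans (sum_norm_light QD Q2) _.
  rewrite ler_peMr ?mulrn_wge0//.
  by rewrite mulrAC ler_pdivlMr// mul1r mulrC -ler_pdivrMr.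
rewrite ltnS in cP; apply: IH => //; apply: leq_trans cP.
apply: fproper_ltn_card.
rewrite fproperEneq fsubsetDl andbT; apply: contraTneq Q1 => PQ.
have -> : Q = fset0.
  by rewrite -(fsetDK QP) PQ fsetDv.
by rewrite big_seq_fset0 -ltNge divr_gt0.
Qed.

End WeightedSums.

Section UniformAbsoluteContinuity.
Variables (R : realType) (A B : R).
Hypothesis ltAB : A < B.
Variable g : interval R -> R.
Hypothesis g_lim : forall I, interval_in A B I -> norm_limit_exists g I.
Hypothesis g_ac : ac_interval_function A B (norm_limit g).
Implicit Types (I J : interval R) (D P Q : {fset interval R}).
Implicit Types (e r delta eps : R) (E U V : set R).

Local Notation leb := (@completed_lebesgue_measure R).

(** Henstock's lemma: complete [P] by short intervals, once as it is and once
with its members replaced by fine divisions; comparing the two divisions of the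
whole interval shows that the sum of [g] over [P] is close to that of the
norm-limit. *)
Lemma henstock eps : 0 < eps -> exists2 eta, 0 < eta & forall P,
  (forall J, J \in P -> interval_in A B J) -> separated_family P ->
  fine_family eta P ->
  `|\sum_(J <- P) g J - \sum_(J <- P) norm_limit g J| <= eps.
Proof.
move=> eps0; have e20 : 0 < eps / 2 by rewrite divr_gt0.
have nW : nondegenerate_itv `[A, B] by [].
have WW : interval_in A B `[A, B] by rewrite /= !lexx ltAB.
have limW := sums_tend_to_Cauchy (norm_limit_sums_tend_to nW (g_lim WW)).
have [eta eta0 H] := limW _ e20; exists eta => // P PW sP fP.
have [Q [fQ dPQ sPQ]] := extend_to_subdivision ltAB eta0 PW sP.
have [|F [FP sumF]] := @fine_replacement _ g P _ _ e20 eta0.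
  by move=> I /PW IW; split; [have /interval_inE[] := IW|exact: g_lim].
have [|sDQ dDQ sumD] := subdivides_refine (F := F) sPQ dPQ.
  by move=> I /FP[].
have fD : fine_family eta (\bigcup_(I <- P) F I)%fset.
  by apply: fine_family_bigcup => I /FP[].
have := H _ _ sPQ (fine_familyU fP fQ) sDQ (fine_familyU fD fQ).
rewrite !big_fsetU_disjoint// sumD opprD addrACA subrr addr0; move: sumF.
rewrite !ler_norml => /andP[h1 h2] /andP[h3 h4]; apply/andP; split; lra.
Qed.

(** [g] is close to the norm-limit on fine families, so it inherits absolute
continuity there. *)
Lemma uniformly_ac eps : 0 < eps -> exists2 delta, 0 < delta & forall P,
  (forall J, J \in P -> interval_in A B J) -> separated_family P ->
  fine_family delta P -> \sum_(J <- P) itv_length J < delta ->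
  `|\sum_(J <- P) g J| <= eps.
Proof.
move=> eps0; have e20 : 0 < eps / 2 by rewrite divr_gt0.
have [eta eta0 H] := henstock e20; have [d d0 K] := g_ac e20.
exists (Num.min eta d); first by rewrite lt_min eta0.
move=> P PW sP fP lP.
have fP' : fine_family eta P by apply: fine_familyW fP; rewrite ge_min lexx.
have nP J : J \in P -> nondegenerate_itv J by move=> /PW/interval_inE[].
have := K P PW ((non_overlappingP nP).2 sP).
have -> : \sum_(J <- P) itv_length J < d by move: lP; rewrite lt_min => /andP[].
move=> /(_ isT)/ltW; have := H P PW sP fP'.
rewrite !ler_norml => /andP[h1 h2] /andP[h3 h4]; apply/andP; split; lra.
Qed.

Lemma uniformly_ac1 eps : 0 < eps -> exists2 delta, 0 < delta & forall J,
  interval_in A B J -> itv_length J < delta -> `|g J| <= eps.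
Proof.
move=> /uniformly_ac[delta delta0 H]; exists delta => // J JW lJ.
have := H [fset J]%fset; rewrite !big_seq_fset1; apply=> //.
- by move=> K; rewrite inE => /eqP ->.
- by move=> K L; rewrite !inE => /eqP -> /eqP ->; rewrite eqxx.
- by move=> K; rewrite inE => /eqP ->.
Qed.

Lemma separated_family_sub P Q : (P `<=` Q)%fset -> separated_family Q ->
  separated_family P.
Proof.
by move=> /fsubsetP PQ sQ J K JP KP; apply: sQ; exact: PQ.
Qed.

Lemma subdivides_in D J : subdivides A B D -> J \in D -> interval_in A B J.
Proof.
move=> sD JD; apply/interval_inE; split.
- exact: subdivides_nondegenerate sD _ JD.
- exact: subdivides_lo sD _ JD.
- exact: subdivides_hi sD _ JD.
Qed.

Lemma light_norm eps : 0 < eps -> exists2 delta, 0 < delta & forall D P,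
  subdivides A B D -> fine_family delta D -> (P `<=` D)%fset ->
  \sum_(J <- P) itv_length J < delta -> \sum_(J <- P) `|g J| <= eps.
Proof.
move=> eps0; have e20 : 0 < eps / 2 by rewrite divr_gt0.
have [delta delta0 H] := uniformly_ac e20; exists delta => // D P sD fD PD lP.
have -> : eps = (eps / 2) *+ 2 by rewrite mulr2n -splitr.
apply: (sum_norm_light (w := @itv_length R) (D := D) _ _ PD lP).
- move=> J JD; apply/ltW/itv_length_gt0.
  exact: subdivides_nondegenerate sD _ JD.
- move=> Q QD lQ; apply: H => //.
  + by move=> J /(fsubsetP QD)/(subdivides_in sD).
  + by apply: separated_family_sub QD _; exact: subdivides_separated sD.
  + by move=> J /(fsubsetP QD)/fD.
Qed.

Lemma bounded_variation : exists M, exists2 delta, 0 < delta & 0 < M /\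
  forall D, subdivides A B D -> fine_family delta D ->
    \sum_(J <- D) `|g J| <= M.
Proof.
have [d d0 H] := uniformly_ac ltr01.
exists (1 *+ 2 * (1 + 2 / d * (B - A))), (d / 2); first by rewrite divr_gt0.
have c0 : 0 < 2 / d by rewrite divr_gt0.
split.
  by rewrite mulr_gt0// ltr_wpDr// mulr_ge0 ?subr_ge0 ?ltW.
move=> D sD fD.
have nD J : J \in D -> nondegenerate_itv J.
  exact: subdivides_nondegenerate sD J.
have := @sum_norm_bounded R g (@itv_length R) 1 d d0 D.
move=> /(_ _ _ _ D (fsubset_refl _))/wrap[].
- by move=> J /nD/itv_length_gt0/ltW.
- exact: fD.
- move=> Q QD lQ; apply: H => //.
  + by move=> J /(fsubsetP QD)/(subdivides_in sD).
  + by apply: separated_family_sub QD _; exact: subdivides_separated sD.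
  + move=> J /(fsubsetP QD)/fD /lt_le_trans; apply.
    by rewrite ler_pdivrMr// ler_peMr ?ler1n// ltW.
move=> /le_trans; apply; rewrite ler_pM2l// lerD2l ler_pM2l//.
apply: sum_length_le => //; last exact: subdivides_separated sD.
by move=> J; exact: subdivides_in.
Qed.

(** A set [V] of small measure has little effect on the density sums: where its
density in [J] exceeds a threshold, the total length of these [J] is small;
elsewhere the variation of [g] is bounded and the density is below the
threshold. *)
Lemma density_small eps : 0 < eps -> exists2 delta, 0 < delta & forall D V,
  subdivides A B D -> fine_family delta D -> lebesgue_measurable V ->
  (leb V <= delta%:E)%E ->
  \sum_(J <- D) `|g J| * (part V J / itv_length J) <= eps.
Proof.
move=> eps0; have e20 : 0 < eps / 2 by rewrite divr_gt0.
have [M [d1 d10 [M0 HM]]] := bounded_variation.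
have [d2 d20 H2] := light_norm e20.
pose s := eps / 2 / M; have s0 : 0 < s by rewrite divr_gt0.
have sd0 : 0 < s * d2 / 2 by rewrite divr_gt0// mulr_gt0.
exists (Num.min (Num.min d1 d2) (s * d2 / 2)); first by rewrite !lt_min d10 d20.
move=> D V sD fD mV leV.
have nD J : J \in D -> nondegenerate_itv J.
  exact: subdivides_nondegenerate sD J.
have lD J : J \in D -> 0 < itv_length J by move=> /nD/itv_length_gt0.
rewrite (big_fsetID _ (fun J => s < part V J / itv_length J)) /=.
set P1 := [fset _ in _ | _]%fset; set P2 := [fset _ in _ | _]%fset.
have P1D : (P1 `<=` D)%fset by exact: fset_sub.
have P2D : (P2 `<=` D)%fset by exact: fset_sub.
have -> : eps = eps / 2 + s * M by rewrite /s divfK ?gt_eqF// -splitr.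
apply: lerD.
- apply: (@le_trans _ _ (\sum_(J <- P1) `|g J|)).
    rewrite big_seq [leRHS]big_seq; apply: ler_sum => J /(fsubsetP P1D) JD.
    rewrite ler_piMr// ler_pdivrMr ?lD// mul1r.
    by apply: part_le_length => //; exact: nD.
  apply: (H2 D) => //.
    by apply: fine_familyW fD; rewrite !ge_min lexx orbT.
  suff : s * \sum_(J <- P1) itv_length J <= s * d2 / 2.
    rewrite -mulrA ler_pM2l// => /le_lt_trans; apply.
    by rewrite ltr_pdivrMr// ltr_pMr// ltr1n.
  apply: (@le_trans _ _ (\sum_(J <- P1) part V J)).
    rewrite mulr_sumr big_seq [leRHS]big_seq; apply: ler_sum => J.
    rewrite !inE /= => /andP[JD]; rewrite ltr_pdivlMr ?lD// => /ltW.
    by [].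
  apply: sum_part_le => //.
  + by move=> J /(fsubsetP P1D)/nD.
  + by apply: separated_family_sub P1D _; exact: subdivides_separated sD.
  + by apply: le_trans leV _; rewrite lee_fin !ge_min lexx !orbT.
- apply: (@le_trans _ _ (s * \sum_(J <- P2) `|g J|)).
    rewrite mulr_sumr big_seq [leRHS]big_seq; apply: ler_sum => J.
    rewrite !inE /= -leNgt => /andP[JD sJ].
    by rewrite mulrC ler_wpM2r.
  rewrite ler_pM2l//; apply: le_trans (HM _ sD _).
    by apply: sum_sub_le.
  by apply: fine_familyW fD; rewrite !ge_min lexx.
Qed.

End UniformAbsoluteContinuity.

(** * Approximation of measurable sets by finite unions of intervals *)

Section Approximation.
Variable R : realType.
Implicit Types (E U V : set R).

Local Notation leb := (@completed_lebesgue_measure R).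

(** Cover [E] economically by countably many half-open intervals and keep
finitely many of them: the rest of the cover and the part of the cover outside
[E] are both small. *)
Lemma approx_by_half_open E delta : lebesgue_measurable E ->
  (leb E < +oo)%E -> 0 < delta ->
  exists (cd : nat -> R * R) (n : nat) (V : set R),
  [/\ lebesgue_measurable V, (leb V <= delta%:E)%E &
    forall t, ~ V t ->
      E t <-> (\bigcup_(i < n) [set` `](cd i).1, (cd i).2]]) t].
Proof.
move=> mE finE delta0; have d20 : 0 < delta / 2 by rewrite divr_gt0.
have fE : leb E \is a fin_num by rewrite ge0_fin_numE.
have [_ [C [mC EC] <-] ltC] := lb_ereal_inf_adherent d20 fE.
have /choice[cd HC] : forall k, exists p : R * R, C k = [set` `]p.1, p.2]].
  move=> k; have /ocitvP[->|[p _ ->]] := mC k; last by exists p.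
  by exists (0, 0); rewrite /= set_itvoc0.
have mC' k : lebesgue_measurable (C k).
  by rewrite HC; exact: lebesgue_measurable_itv.
pose G : set R := \bigcup_k C k; pose U n : set R := \bigcup_(i < n) C i.
have mG : lebesgue_measurable G by exact: lebesgue_measurable_bigcup.
have mU n : lebesgue_measurable (U n).
  by apply: bigcup_measurable => k _; exact: mC'.
have leG : (leb G <= leb E + (delta / 2)%:E)%E.
  apply: le_trans (ltW ltC).
  apply: le_trans (measure_sigma_subadditive leb _ _ (@subset_refl _ _)) _ => //.
  apply: lee_nneseries => // k _.
  by rewrite [leLHS](measurable_mu_extE (wlength idfun)).
have finG : (leb G < +oo)%E.
  by apply: le_lt_trans leG _; rewrite lte_add_pinfty// ltry.
have leGE : (leb (G `\` E) <= (delta / 2)%:E)%E.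
  have -> : leb (G `\` E) = (leb G - leb (G `&` E))%E.
    by apply: measureD; [exact: mG|exact: mE|exact: finG].
  by rewrite setIidr// leeBlDl.
have tail : (leb \o (fun n => G `\` U n)) @ \oo --> leb (\bigcap_n (G `\` U n)).
  apply: nonincreasing_cvg_mu.
  - by apply: le_lt_trans finG; apply: leb_le => //; exact: lebesgue_measurableD.
  - by move=> n; exact: lebesgue_measurableD.
  - by apply: bigcapT_measurable => n; exact: lebesgue_measurableD.
  - move=> m n mn; apply/subsetPset; apply: setDS => t [i /= im Ct].
    by exists i => //=; exact: leq_trans mn.
have cap0 : \bigcap_n (G `\` U n) = set0.
  rewrite -subset0 => t Gt; have [[k _ Ct] _] := Gt 0%N I.
  by have [_] := Gt k.+1 I; apply; exists k => /=.
move: tail; rewrite cap0 measure0 => /fine_cvgP[finF /cvgr0Pnorm_lt/(_ _ d20) ltF].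
have [n [finn ltn]] : exists n, leb (G `\` U n) \is a fin_num /\
    `|fine (leb (G `\` U n))| < delta / 2.
  near \oo => n; exists n; split; near: n; [exact: finF|exact: ltF].
exists cd, n, ((G `\` E) `|` (G `\` U n)); split.
- by apply: lebesgue_measurableU; exact: lebesgue_measurableD.
- apply: le_trans (leb_setU_le _ _) _; try exact: lebesgue_measurableD.
  rewrite [delta]splitr EFinD leeD// -(fineK finn) lee_fin.
  by apply: le_trans (ler_norm _) (ltW ltn).
- move=> t nV.
  have UE : (\bigcup_(i < n) [set` `](cd i).1, (cd i).2]]) t <-> U n t.
    by split=> -[i ltin Ct]; exists i => //; rewrite HC in Ct *.
  rewrite UE; split=> [Et|Ut]; apply: contrapT => nt; apply: nV.
  + by right; split=> //; exact: EC.
  + by left; split=> //; case: Ut => i _ Ct; exists i.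
Unshelve. all: by end_near. Qed.

End Approximation.

(** * Clipping a division to a subinterval *)

Section Covering.
Variable R : realType.
Implicit Types (I J K : interval R) (D : {fset interval R}) (a b t : R).

(** Look at the member containing a point slightly to the right of [t], before
the next left end-point. *)
Lemma subdivides_cover_right a b D t : subdivides a b D -> a <= t -> t < b ->
  exists J, [/\ J \in D, lo J <= t & t < hi J].
Proof.
move=> sD at_ tb.
have [m [tm mb mD]] : exists m, [/\ t < m, m <= b &
    forall J, J \in enum_fset D -> lo J <= t \/ m <= lo J].
  elim: (enum_fset D) => [|J s [m [tm mb ms]]]; first by exists b.
  have [Jt|tJ] := leP (lo J) t.
    exists m; split=> // K; rewrite inE => /predU1P[->|/ms//].
    by left.
  exists (Num.min m (lo J)); split; first by rewrite lt_min tm.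
    by rewrite ge_min mb.
  move=> K; rewrite inE => /predU1P[->|/ms[|mK]]; [|by left|].
    by right; rewrite ge_min lexx orbT.
  by right; rewrite ge_min mK.
have [||J [JD lJ hJ]] := subdivides_cover sD (t := (t + m) / 2); [lra|lra|].
by exists J; split=> //; have [//|?] := mD J JD; lra.
Qed.

Lemma subdivides_cover_left a b D t : subdivides a b D -> a < t -> t <= b ->
  exists J, [/\ J \in D, lo J < t & t <= hi J].
Proof.
move=> sD at_ tb.
have [m [mt am mD]] : exists m, [/\ m < t, a <= m &
    forall J, J \in enum_fset D -> t <= hi J \/ hi J <= m].
  elim: (enum_fset D) => [|J s [m [mt am ms]]]; first by exists a.
  have [tJ|Jt] := leP t (hi J).
    exists m; split=> // K; rewrite inE => /predU1P[->|/ms//].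
    by left.
  exists (Num.max m (hi J)); split; first by rewrite gt_max mt.
    by rewrite le_max am.
  move=> K; rewrite inE => /predU1P[->|/ms[|mK]]; [|by left|].
    by right; rewrite le_max lexx orbT.
  by right; rewrite le_max mK.
have [||J [JD lJ hJ]] := subdivides_cover sD (t := (t + m) / 2); [lra|lra|].
by exists J; split=> //; have [//|?] := mD J JD; lra.
Qed.

(** Members that already lie in [c, d] are kept with their brackets, because
[g] may depend on these. *)
Definition clip c d J : interval R :=
  if (c <= lo J) && (hi J <= d) then J
  else `[Num.max (lo J) c, Num.min (hi J) d].

Definition meets (c d : R) J := (lo J < d) && (c < hi J).

Lemma lo_clip c d J : lo (clip c d J) = Num.max (lo J) c.
Proof.
rewrite /clip; case: ifP => // /andP[cJ _].
by symmetry; apply/max_idPl.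
Qed.

Lemma hi_clip c d J : hi (clip c d J) = Num.min (hi J) d.
Proof.
rewrite /clip; case: ifP => // /andP[_ Jd].
by symmetry; apply/min_idPl.
Qed.

Lemma clip_nondegenerate c d J : c < d -> nondegenerate_itv J ->
  meets c d J -> nondegenerate_itv (clip c d J).
Proof.
move=> cd nJ /andP[h1 h2]; rewrite /clip; case: ifP => // _ /=.
by rewrite lt_min !gt_max h1 h2 cd nondegenerate_lo_hi.
Qed.

Lemma clip_separated c d J K : separated J K ->
  separated (clip c d J) (clip c d K).
Proof.
rewrite /separated !lo_clip !hi_clip => /orP[h|h]; apply/orP; [left|right];
  by rewrite ge_min !le_max h.
Qed.

Lemma clip_length c d J : c < d -> nondegenerate_itv J -> meets c d J ->
  itv_length (clip c d J) <= itv_length J.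
Proof.
move=> cd nJ mJ; rewrite !itv_lengthE ?clip_nondegenerate// lo_clip hi_clip.
by apply: lerB; rewrite ?ge_min ?le_max lexx.
Qed.

Definition clip_family c d D : {fset interval R} :=
  [fset clip c d J | J in [fset J in D | meets c d J]]%fset.

Lemma clip_inj c d D : c < d -> (forall J, J \in D -> nondegenerate_itv J) ->
  separated_family D -> {in [fset J in D | meets c d J]%fset &,
    injective (clip c d)}.
Proof.
move=> cd nD sD J K; rewrite !inE /= => /andP[JD mJ] /andP[KD mK] JK.
apply: contrapT => /eqP nJK; have := clip_separated c d (sD _ _ JD KD nJK).
by rewrite -JK not_separated_self// clip_nondegenerate// nD.
Qed.

(** Members that touch [c, d] in an end-point only are dropped; the end-points
stay covered because of the one-sided covering lemmas. *)
Lemma clip_subdivides a b c d D : a <= c -> c < d -> d <= b ->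
  subdivides a b D -> subdivides c d (clip_family c d D).
Proof.
move=> ac cd db sD; have nD J : J \in D -> nondegenerate_itv J.
  exact: subdivides_nondegenerate sD J.
have clipP J : J \in clip_family c d D -> exists K,
    [/\ K \in D, meets c d K & J = clip c d K].
  by move=> /imfsetP[K /=]; rewrite !inE /= => /andP[KD mK] ->; exists K.
have clipI J : J \in D -> meets c d J -> clip c d J \in clip_family c d D.
  by move=> JD mJ; apply/imfsetP; exists J; rewrite // !inE JD.
split.
- by move=> J /clipP[K [KD mK ->]]; apply: clip_nondegenerate => //; exact: nD.
- move=> J J' /clipP[K [KD mK ->]] /clipP[K' [KD' mK' ->]] KK'.
  apply: clip_separated; apply: (subdivides_separated sD) => //.
  by apply: contraNneq KK' => ->.
- by move=> J /clipP[K [KD mK ->]]; rewrite lo_clip le_max lexx orbT.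
- by move=> J /clipP[K [KD mK ->]]; rewrite hi_clip ge_min lexx orbT.
move=> t ct td.
suff [J [JD mJ lJ hJ]] : exists J, [/\ J \in D, meets c d J, lo J <= t & t <= hi J].
  exists (clip c d J); split; first exact: clipI.
    by rewrite lo_clip ge_max lJ.
  by rewrite hi_clip le_min hJ.
have [td'|dt] := ltP t d.
  have [||J [JD lJ hJ]] := subdivides_cover_right sD (t := t).
  - exact: le_trans ct.
  - exact: lt_le_trans td' db.
  exists J; split=> //; last exact: ltW.
  by rewrite /meets (le_lt_trans lJ td') (le_lt_trans ct hJ).
have [||J [JD lJ hJ]] := subdivides_cover_left sD (t := t).
- exact: le_lt_trans ac (lt_le_trans cd dt).
- exact: le_trans td db.
exists J; split=> //; last exact: ltW.
by rewrite /meets (lt_le_trans lJ td) (lt_le_trans (lt_le_trans cd dt) hJ).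
Qed.

Definition straddles p J := (lo J < p) && (p < hi J).

(** Two intervals with a common interior point overlap. *)
Lemma count_straddles p D : separated_family D ->
  \sum_(J <- D) (straddles p J)%:R <= 1 :> R.
Proof.
move=> sD; have [[J JD pJ]|noJ] := pselect (exists2 J, J \in D & straddles p J).
  rewrite (big_fsetD1 J)//= pJ.
  suff -> : \sum_(K <- (D `\ J)%fset) (straddles p K)%:R = 0 :> R by rewrite addr0.
  apply: big1_seq => K /andP[_]; rewrite !inE => /andP[KJ KD].
  case pK: (straddles p K) => //; move: pK pJ.
  rewrite /straddles => /andP[h1 h2] /andP[h3 h4].
  by have /orP[h|h] := sD K J KD JD KJ; exfalso; lra.
suff -> : \sum_(J <- D) (straddles p J)%:R = 0 :> R by [].
apply: big1_seq => K /andP[_ KD]; case pK: (straddles p K) => //.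
by exfalso; apply: noJ; exists K.
Qed.

End Covering.

(** * Sufficiency: density sums of intervals and measurable sets *)

Section Sufficiency.
Variables (R : realType) (A B : R).
Hypothesis ltAB : A < B.
Variable g : interval R -> R.
Hypothesis g_lim : forall I, interval_in A B I -> norm_limit_exists g I.
Hypothesis g_ac : ac_interval_function A B (norm_limit g).
Implicit Types (I J K : interval R) (D P Q : {fset interval R}).
Implicit Types (c d delta eps : R) (E F U V : set R).

Local Notation leb := (@completed_lebesgue_measure R).
Local Notation S := (density_sum g).

Lemma density_norm_le E J : lebesgue_measurable E -> nondegenerate_itv J ->
  `|density_fun g E J| <= `|g J|.
Proof.
move=> mE nJ; have lJ := itv_length_gt0 nJ.
rewrite density_funE -mulrA normrM ler_piMr//.
rewrite ger0_norm; last by rewrite divr_ge0 ?part_ge0// ltW.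
by rewrite ler_pdivrMr// mul1r part_le_length.
Qed.

(** Clipping a fine division of [A, B] to [c, d] changes at most two terms of
the density sum, and single terms are small; the clipped sum tends to the
norm-limit over [c, d]. *)
Lemma interval_tends_to E c d : lebesgue_measurable E ->
  A <= c -> c < d -> d <= B ->
  (forall t, c < t < d -> E t) ->
  (forall t, E t -> A <= t -> t <= B -> c <= t <= d) ->
  sums_tend_to (density_fun g E) A B (norm_limit g `[c, d]).
Proof.
move=> mE Ac cd dB cdE Ecd eps eps0.
have IW : interval_in A B `[c, d] by rewrite /= Ac cd dB.
have e20 : 0 < eps / 2 by rewrite divr_gt0.
have e80 : 0 < eps / 8 by rewrite divr_gt0.
have [eta eta0 H] := norm_limit_sums_tend_to (I := `[c, d]) cd (g_lim IW) e20.
have [kap kap0 K] := uniformly_ac1 ltAB g_lim g_ac e80.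
exists (Num.min eta kap); first by rewrite lt_min eta0.
move=> D sD fD; have nD J : J \in D -> nondegenerate_itv J.
  exact: subdivides_nondegenerate sD J.
have feta : fine_family eta D by apply: fine_familyW fD; rewrite ge_min lexx.
have fkap : fine_family kap D.
  by apply: fine_familyW fD; rewrite ge_min lexx orbT.
have sC := clip_subdivides Ac cd dB sD.
have fC : fine_family eta (clip_family c d D).
  move=> J /imfsetP[J' /=]; rewrite !inE /= => /andP[J'D mJ'] ->.
  exact: le_lt_trans (clip_length cd (nD _ J'D) mJ') (feta _ J'D).
have := H _ sC fC.
have -> : \sum_(J <- clip_family c d D) g J =
    \sum_(J <- D) if meets c d J then g (clip c d J) else 0.
  rewrite /clip_family big_imfset /=; last first.
    by apply: clip_inj => //; exact: subdivides_separated sD.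
  rewrite -big_mkcond /= [RHS]big_fset_condE.
  by apply: eq_fbigl => J; rewrite !inE.
have term J : J \in D -> `|density_fun g E J -
    (if meets c d J then g (clip c d J) else 0)| <=
    eps / 4 * (straddles c J)%:R + eps / 4 * (straddles d J)%:R.
  move=> JD; have nJ := nD _ JD; have ltJ := nondegenerate_lo_hi nJ.
  have /interval_inE[_ AJ JB] := subdivides_in sD JD.
  have EJ t : E t -> t \in J -> c <= t <= d.
    move=> Et /(nondegenerate_mem_ge nJ)/andP[h1 h2].
    by apply: Ecd => //; [exact: le_trans h1|exact: le_trans JB].
  have [strad|] := boolP (straddles c J || straddles d J).
    apply: (@le_trans _ _ (eps / 4)).
      have -> : eps / 4 = eps / 8 + eps / 8 by lra.
      apply: le_trans (ler_normB _ _) _; apply: lerD.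
        apply: le_trans (density_norm_le mE nJ) _.
        by apply: K; [exact/interval_inE|exact: fkap].
      case: ifP => mJ; last by rewrite normr0 ltW.
      apply: K; last first.
        exact: le_lt_trans (clip_length cd nJ mJ) (fkap _ JD).
      apply/interval_inE; split; first exact: clip_nondegenerate.
        by rewrite lo_clip le_max Ac orbT.
      by rewrite hi_clip ge_min dB orbT.
    have e40 : 0 <= eps / 4 by rewrite divr_ge0// ltW.
    rewrite -mulrDr ler_peMr// -natrD ler1n.
    by move: strad; case: straddles; case: straddles.
  rewrite negb_or => /andP[/negbTE nc /negbTE nd]; rewrite nc nd !mulr0 addr0.
  move: nc nd; rewrite /straddles => /negbT; rewrite negb_and -!leNgt => nc.
  move=> /negbT; rewrite negb_and -!leNgt => nd.
  rewrite normr_le0 subr_eq0; apply/eqP.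
  have [hc|ch] := leP (hi J) c.
    rewrite /meets [c < hi J]ltNge hc andbF.
    apply: (@density_null _ _ _ _ c) => // t Et tJ.
    have /andP[ct _] := EJ t Et tJ.
    have /andP[_ tJ'] := nondegenerate_mem_ge nJ tJ.
    by apply/eqP; rewrite eq_le ct (le_trans tJ').
  have [dl|ld] := leP d (lo J).
    rewrite /meets [lo J < d]ltNge dl /=.
    apply: (@density_null _ _ _ _ d) => // t Et tJ.
    have /andP[_ td] := EJ t Et tJ.
    have /andP[Jt _] := nondegenerate_mem_ge nJ tJ.
    by apply/eqP; rewrite eq_le td (le_trans dl).
  have cJ : c <= lo J by case/orP: nc => // /le_lt_trans/(_ ch); rewrite ltxx.
  have Jd : hi J <= d.
    by case/orP: nd => // /le_lt_trans/(_ ld); rewrite ltxx.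
  rewrite /meets ld ch /= /clip cJ Jd /=; apply: density_full => //.
  move=> t /andP[h1 h2]; apply: cdE.
  by rewrite (le_lt_trans cJ h1) (lt_le_trans h2).
have dist : `|\sum_(J <- D) density_fun g E J -
    \sum_(J <- D) (if meets c d J then g (clip c d J) else 0)| <= eps / 2.
  rewrite -sumrB; apply: le_trans (ler_norm_sum _ _ _) _.
  apply: (@le_trans _ _ (\sum_(J <- D) (eps / 4 * (straddles c J)%:R +
      eps / 4 * (straddles d J)%:R))).
    by rewrite big_seq [leRHS]big_seq; apply: ler_sum.
  have -> : eps / 2 = eps / 4 * 1 + eps / 4 * 1 by lra.
  have e40 : 0 < eps / 4 by rewrite divr_gt0.
  rewrite big_split /= -!mulr_sumr; apply: lerD; rewrite ler_pM2l//;
    by apply: count_straddles; exact: subdivides_separated sD.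
move: dist; rewrite !ler_norml => /andP[h1 h2] /andP[h3 h4].
by apply/andP; split; lra.
Qed.

Lemma half_open_Cauchy c d : Cauchy_sums (density_fun g `]c, d]) A B.
Proof.
pose c' := Num.max c A; pose d' := Num.min d B.
have mE : lebesgue_measurable [set` `]c, d]] by exact: lebesgue_measurable_itv.
have Ecd (t : R) : [set` `]c, d]] t -> A <= t -> t <= B -> c' <= t <= d'.
  rewrite /= in_itv/= => /andP[ct td] At tB.
  by rewrite ge_max le_min At tB td ltW.
have [cd'|dc'] := ltP c' d'.
  apply: sums_tend_to_Cauchy; apply: interval_tends_to mE _ cd' _ _ Ecd.
  - by rewrite le_max lexx orbT.
  - by rewrite ge_min lexx orbT.
  - move=> t; rewrite gt_max lt_min => /andP[/andP[h1 _] /andP[h2 _]] /=.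
    by rewrite in_itv/= h1 ltW.
move=> eps eps0; exists 1 => // D D' sD _ sD' _.
have zero P : subdivides A B P -> \sum_(J <- P) density_fun g `]c, d] J = 0.
  move=> sP; rewrite big1_seq// => J /andP[_ JP].
  have nJ := subdivides_nondegenerate sP JP.
  apply: (@density_null _ _ _ _ c') => // t Et.
  move=> /(nondegenerate_mem_ge nJ)/andP[Jt tJ].
  have /andP[h1 h2] := Ecd t Et (le_trans (subdivides_lo sP JP) Jt)
    (le_trans tJ (subdivides_hi sP JP)).
  by apply/eqP; rewrite eq_le h1 (le_trans h2).
by rewrite !zero// subrr normr0 ltW.
Qed.

(** Inclusion-exclusion for density sums. *)
Lemma Cauchy_setU E F : lebesgue_measurable E -> lebesgue_measurable F ->
  Cauchy_sums (density_fun g E) A B -> Cauchy_sums (density_fun g F) A B ->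
  Cauchy_sums (density_fun g (E `&` F)) A B ->
  Cauchy_sums (density_fun g (E `|` F)) A B.
Proof.
move=> mE mF cE cF cEF eps eps0; have e30 : 0 < eps / 3 by rewrite divr_gt0.
have [e1 e10 H1] := cE _ e30; have [e2 e20 H2] := cF _ e30.
have [e3 e30' H3] := cEF _ e30.
exists (Num.min (Num.min e1 e2) e3); first by rewrite !lt_min e10 e20.
move=> D D' sD fD sD' fD'.
have split3 P : subdivides A B P ->
    fine_family (Num.min (Num.min e1 e2) e3) P ->
    [/\ fine_family e1 P, fine_family e2 P, fine_family e3 P &
     \sum_(J <- P) density_fun g (E `|` F) J =
     \sum_(J <- P) density_fun g E J + \sum_(J <- P) density_fun g F J -
     \sum_(J <- P) density_fun g (E `&` F) J].
  move=> sP fP; split.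
  - by apply: fine_familyW fP; rewrite !ge_min lexx.
  - by apply: fine_familyW fP; rewrite !ge_min lexx orbT.
  - by apply: fine_familyW fP; rewrite !ge_min lexx !orbT.
  - by apply: density_sum_modular => //; exact: subdivides_nondegenerate sP.
have [f1 f2 f3 ->] := split3 _ sD fD; have [f1' f2' f3' ->] := split3 _ sD' fD'.
have := H1 _ _ sD f1 sD' f1'; have := H2 _ _ sD f2 sD' f2'.
have := H3 _ _ sD f3 sD' f3'; rewrite !ler_norml.
move=> /andP[h1 h2] /andP[h3 h4] /andP[h5 h6]; apply/andP; split; lra.
Qed.

Lemma half_openI c d c' d' :
  [set` `]c, d]] `&` [set` `]c', d']] = [set` `]Num.max c c', Num.min d d']].
Proof.
apply/seteqP; split=> t /=; rewrite !in_itv/= gt_max le_min.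
  by move=> [/andP[-> ->] /andP[-> ->]].
by move=> /andP[/andP[-> ->] /andP[-> ->]].
Qed.

(** The window ]c, d] makes the induction go through: the new interval meets
the previous union in a union of the same kind, seen through a smaller
window. *)
Lemma Cauchy_finite_union (cd : nat -> R * R) n c d :
  Cauchy_sums (density_fun g
    ((\bigcup_(i < n) [set` `](cd i).1, (cd i).2]]) `&` [set` `]c, d]])) A B.
Proof.
elim: n c d => [|n IH] c d.
  rewrite bigcup_mkord big_ord0 set0I.
  (* The empty set is a degenerate half-open interval. *)
  have -> : @set0 R = [set` `]0, 0]] by rewrite /= set_itvoc0.
  exact: half_open_Cauchy.
have mI a b : lebesgue_measurable [set` `]a, b]].
  exact: lebesgue_measurable_itv.
rewrite bigcup_mkord big_ord_recr /=.
rewrite -(bigcup_mkord n (fun i => [set` `](cd i).1, (cd i).2]])) setIUl.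
apply: Cauchy_setU.
- apply: lebesgue_measurableI => //; apply: bigcup_measurable => k _; exact: mI.
- exact: lebesgue_measurableI.
- exact: IH.
- by rewrite half_openI; exact: half_open_Cauchy.
- rewrite half_openI -setIA half_openI; exact: IH.
Qed.

Lemma sufficient_Cauchy E : E `<=` `[A, B] -> lebesgue_measurable E ->
  Cauchy_sums (density_fun g E) A B.
Proof.
move=> EW mE eps eps0; have e30 : 0 < eps / 3 by rewrite divr_gt0.
have [delta delta0 small] := density_small ltAB g_lim g_ac e30.
have finE : (leb E < +oo)%E.
  apply: (@le_lt_trans _ _ (leb [set` `[A, B]])).
    by apply: leb_le => //; exact: lebesgue_measurable_itv.
  by rewrite leb_itv ?ltry.
have [cd [n [V [mV leV EV]]]] := approx_by_half_open mE finE delta0.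
set U0 := \bigcup_(i < n) _ in EV.
(* The finite union is only controlled through a window; this one contains the
   closed interval. *)
pose U := U0 `&` [set` `](A - 1), B]].
have mU : lebesgue_measurable U.
  apply: lebesgue_measurableI; last exact: lebesgue_measurable_itv.
  by apply: bigcup_measurable => k _; exact: lebesgue_measurable_itv.
have [eta eta0 H] := Cauchy_finite_union cd n (A - 1) B e30.
exists (Num.min eta delta); first by rewrite lt_min eta0.
move=> D D' sD fD sD' fD'.
have close P : subdivides A B P -> fine_family (Num.min eta delta) P ->
    fine_family eta P /\ `|S P E - S P U| <= eps / 3.
  move=> sP fP; split; first by apply: fine_familyW fP; rewrite ge_min lexx.
  have fP' : fine_family delta P.
    by apply: fine_familyW fP; rewrite ge_min lexx orbT.
  apply: le_trans (small _ _ sP fP' mV leV).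
  apply: density_sum_dist => //; first by exact: subdivides_nondegenerate sP.
  move=> t nVt; split=> [Et|[U0t _]]; last exact/(EV t nVt).
  split; first exact/(EV t nVt).
  by have := EW t Et; rewrite /= !in_itv/= => /andP[h1 h2]; apply/andP; split; lra.
have [f1 d1] := close _ sD fD; have [f2 d2] := close _ sD' fD'.
have := H _ _ sD f1 sD' f2; rewrite -/U -![\sum_(J <- _) _]/(density_sum _ _ _).
move: d1 d2; rewrite !ler_norml.
move=> /andP[h1 h2] /andP[h3 h4] /andP[h5 h6]; apply/andP; split; lra.
Qed.

End Sufficiency.

(** * The theorem *)

Section DensityIntegrals.
Variables (R : realType) (A B : R) (g : interval R -> R) (E : set R).
Hypothesis ltAB : A < B.

Lemma density_integralsP :
  finite_and_equal (upper_density_integral A B g E)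
                   (lower_density_integral A B g E) <->
  Cauchy_sums (density_fun g E) A B.
Proof.
have nW : nondegenerate_itv `[A, B] by [].
split=> [h|]; last exact: (@Cauchy_sums_norm_limit _ `[A, B]).
exact: sums_tend_to_Cauchy (@norm_limit_sums_tend_to _ `[A, B] _ nW h).
Qed.

End DensityIntegrals.

Theorem mainTheorem18 (R : realType) (A B : R) (ltAB : A < B)
    (g : interval R -> R) :
  (forall E : set R, E `<=` `[A, B] -> lebesgue_measurable E ->
     finite_and_equal (upper_density_integral A B g E)
                      (lower_density_integral A B g E))
  <->
  ((forall I : interval R, interval_in A B I -> norm_limit_exists g I) /\
   ac_interval_function A B (norm_limit g)).
Proof.
split=> [h|[g_lim g_ac] E EW mE].
  have {}h E : E `<=` `[A, B] -> lebesgue_measurable E ->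
      Cauchy_sums (density_fun g E) A B.
    by move=> EW mE; apply/density_integralsP => //; exact: h.
  split; first by move=> I; exact: necessary_norm_limit.
  exact: necessary_absolute_continuity.
by apply/density_integralsP => //; exact: sufficient_Cauchy.
Qed.
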